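(* Let $\mathsf V$ be a monoidal pseudovariety of semigroups containing $\mathcal{L}\mathsf{Sl}$ and such that $\mathsf V=\mathsf V\ast\mathsf D$. If $\mathcal X$ and $\mathcal Y$ are flow equivalent subshifts (over possibly different alphabets), then the compact categories $\mathbb K(\mathcal M_{\mathsf V}(\mathcal X))$ and $\mathbb K(\mathcal M_{\mathsf V}(\mathcal Y))$ are continuously equivalent.
   Context: Alphabets are finite nonempty sets; $A^+$ is the free semigroup on $A$. Compact spaces are Hausdorff. A pseudovariety of semigroups is a class of finite semigroups closed under subsemigroups, homomorphic images and finite direct products; it is monoidal if it is generated (as a pseudovariety) by a class of finite monoids. $\mathcal L\mathsf{Sl}$ is the class of finite semigroups $S$ such that $eSe$ is a semilattice (commutative, all elements idempotent) for every idempotent $e$ of $S$. $\mathsf D$ is the class of finite semigroups $S$ with $Se=\{e\}$ for every idempotent $e$ of $S$. $\mathsf V\ast\mathsf W$ is the least pseudovariety containing all semidirect products (for left actions) of an element of $\mathsf V$ with an element of $\mathsf W$. $\widehat F_{\mathsf V}(A)$ is the free pro-$\mathsf V$ semigroup on $A$, i.e. the inverse limit of the finite quotients of $A^+$ belonging to $\mathsf V$. If $\mathsf V\supseteq\mathcal L\mathsf{Sl}$, $A^+$ embeds in it as a dense subsemigroup of isolated points. A subshift of $A^{\mathbb Z}$ is a nonempty closed set $\mathcal X\subseteq A^{\mathbb Z}$ with $\sigma_A(\mathcal X)=\mathcal X$, where $\sigma_A((x_i)_i)=(x_{i+1})_i$. $L(\mathcal X)\subseteq A^+$ is the set of nonempty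 finite words occurring in elements of $\mathcal X$. Two subshifts are conjugate if there is a homeomorphism between them commuting with the shift maps. The mirage $\mathcal M_{\mathsf V}(\mathcal X)$ is the set of $u\in\widehat F_{\mathsf V}(A)$ all of whose factors in $A^+$ belong to $L(\mathcal X)$. Flow equivalence of subshifts (conjugacy of suspension flows up to a time change) is, by Parry and Sullivan, the equivalence relation on subshifts generated by conjugacy and symbol expansion. Symbol expansion: given $\mathcal X\subseteq A^{\mathbb Z}$, a letter $\alpha\in A$ and a letter $\diamond\notin A$, put $B=A\cup\{\diamond\}$ and let $\mathcal E\colon A^+\to B^+$ be the homomorphism with $\mathcal E(\alpha)=\alpha\diamond$ and $\mathcal E(a)=a$ for $a\in A\setminus\{\alpha\}$; the symbol expansion of $\mathcal X$ relative to $\alpha$ is the least subshift $\mathcal X'$ of $B^{\mathbb Z}$ with $\mathcal E(L(\mathcal X))\subseteq L(\mathcal X')$. A compact category is a small category whose sets of objects and of arrows are compact spaces such that domain, codomain, $x\mapsto 1_x$, and composition are continuous. For a compact semigroup $S$, the Karoubi envelope $\mathbb K(S)$ has as objects the idempotents of $S$, and as arrows $f\to e$ the triples $(e,s,f)$ with $s\in S$, $s=esf$; composition is $(e,s,f)(f,t,g)=(e,st,g)$ and topologies are induced from $S$ and $S\times S\times S$. $\mathbb K(\mathcal M_{\mathsf V}(\mathcal X))$ is the compact subcategory of $\mathbb K(\widehat F_{\mathsf V}(A))$ whose objects are the idempotents in $\mathcal M_{\mathsf V}(\mathcal X)$ and whose arrows are the $(e,u,f)$ with $u\in\mathcal M_{\mathsf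 V}(\mathcal X)$. A functor between compact categories is continuous if it is continuous on objects and on arrows. Continuous functors $F,G\colon C\to D$ between compact categories are continuously isomorphic ($F\cong G$) if there is a natural isomorphism $\eta\colon F\Rightarrow G$ such that $c\mapsto\eta_c$ is continuous from the space of objects of $C$ to the space of arrows of $D$. $C$ and $D$ are continuously equivalent if there are continuous functors $F\colon C\to D$ and $G\colon D\to C$ with $F\circ G\cong 1_D$ and $G\circ F\cong 1_C$. *)

(* Defs.v *)
From HB Require Import structures.
From mathcomp Require Import all_boot all_order all_algebra.
From mathcomp Require Import generic_quotient.
From mathcomp Require Import all_classical all_reals topology.

Set Implicit Arguments.
Unset Strict Implicit.
Unset Printing Implicit Defensive.

Local Open Scope classical_set_scope.
Local Open Scope group_scope.
Local Open Scope quotient_scope.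

(* The empty semigroup is not excluded; this is harmless, since adding it to
   every class is compatible with all the constructions below and quotients of
   [A^+] are nonempty. *)
#[short(type="finSemigroupType")]
HB.structure Definition FinSemigroup := {S of Semigroup S & Finite S}.

HB.instance Definition _ (S T : finSemigroupType) := Semigroup.on (S * T)%type.

Definition idem (S : magmaType) (e : S) : Prop := e * e = e.

Record is_pseudovariety (V : finSemigroupType -> Prop) : Prop := {
  pv_sub : forall (S T : finSemigroupType) (f : {multiplicative S -> T}),
    injective f -> V T -> V S;
  pv_img : forall (S T : finSemigroupType) (f : {multiplicative S -> T}),
    (forall y, exists x, f x = y) -> V S -> V T;
  pv_triv : forall S : finSemigroupType, #|S| = 1%N -> V S;
  pv_prod : forall S T : finSemigroupType, V S -> V T -> V (S * T)%type }.

Record pseudovariety := Pseudovariety {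
  pv_class :> finSemigroupType -> Prop;
  pvP : is_pseudovariety pv_class }.

Definition generated (C : finSemigroupType -> Prop) (S : finSemigroupType) :=
  forall U : pseudovariety, (forall T, C T -> U T) -> U S.

Definition monoidal (V : finSemigroupType -> Prop) :=
  exists C : finSemigroupType -> Prop,
    (forall S, C S -> exists e : S, forall x, e * x = x /\ x * e = x) /\
    (forall S, V S <-> generated C S).

Definition LSl (S : finSemigroupType) : Prop :=
  forall e : S, idem e ->
    (forall x y, (e * x * e) * (e * y * e) = (e * y * e) * (e * x * e)) /\
    (forall x, idem (e * x * e)).

Definition Dpv (S : finSemigroupType) : Prop :=
  forall e s : S, idem e -> s * e = e.

(* Semigroup actions by endomorphisms; an identity of [T], if there is one, is
   not required to act as the identity. When [T] ranges over [Dpv], requiring it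
   generates the same pseudovariety: the only monoid there is trivial, and an
   action of it can be pulled back to a two-element right zero semigroup. *)
Record left_action (S T : finSemigroupType) := LeftAction {
  lact :> T -> S -> S;
  lactM : forall t s s', lact t (s * s') = lact t s * lact t s';
  lactA : forall t t' s, lact (t * t') s = lact t (lact t' s) }.

(* The action is a phantom parameter: it keys the multiplication. *)
Definition semidirect (S T : finSemigroupType) (a : left_action S T) : Type :=
  (S * T)%type.

Section Semidirect.
Variables (S T : finSemigroupType) (a : left_action S T).

HB.instance Definition _ := Finite.copy (semidirect a) (S * T)%type.

Definition sdmul (x y : semidirect a) : semidirect a :=
  (x.1 * a x.2 y.1, x.2 * y.2).

Lemma sdmulA : associative sdmul.
Proof.
by move=> [x1 x2] [y1 y2] [z1 z2]; rewrite /sdmul/= lactM lactA !mulgA.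
Qed.

HB.instance Definition _ := isSemigroup.Build (semidirect a) sdmulA.

End Semidirect.

Definition semidirect_pv (V W : finSemigroupType -> Prop) :=
  generated (fun P => exists (S T : finSemigroupType) (a : left_action S T),
    [/\ V S, W T & P = (semidirect a : finSemigroupType)]).

Record word (A : finType) := Word { wseq :> seq A; _ : wseq != [::] }.

HB.instance Definition _ A := [isSub for @wseq A].
HB.instance Definition _ A := [Choice of word A by <:].

Section Words.
Variable A : finType.

Lemma wcat_subproof (u v : word A) : wseq u ++ wseq v != [::].
Proof. by case: u => [[]]. Qed.

Definition wcat (u v : word A) : word A := Word (wcat_subproof u v).

Lemma wcatA : associative wcat.
Proof. by move=> u v w; apply: val_inj; rewrite /= catA. Qed.

HB.instance Definition _ := isSemigroup.Build (word A) wcatA.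

End Words.

Record congruence (A : finType) := Congruence {
  cong_rel :> equiv_rel (word A);
  cong_mul : forall u u' v v' : word A,
    cong_rel u u' -> cong_rel v v' -> cong_rel (u * v) (u' * v') }.

Section QuotientSemigroup.
Variables (A : finType) (r : congruence A).

Definition wquot : Type := {eq_quot cong_rel r}.

HB.instance Definition _ := Choice.copy wquot {eq_quot cong_rel r}.
HB.instance Definition _ := EqQuotient.copy wquot {eq_quot cong_rel r}.

Definition qmul (x y : wquot) : wquot := \pi_wquot (repr x * repr y).

Lemma pi_eqP (u v : word A) : \pi_wquot u = \pi_wquot v <-> r u v.
Proof. by split=> [/eqP|h]; [|apply/eqP]; rewrite pi_eq_quot. Qed.

Lemma pi_qmul u v : \pi_wquot (u * v) = qmul (\pi_wquot u) (\pi_wquot v).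
Proof.
by apply/pi_eqP; apply: cong_mul; apply/pi_eqP; rewrite reprK.
Qed.

Lemma qmulA : associative qmul.
Proof.
move=> x y z; rewrite -[x]reprK -[y]reprK -[z]reprK.
move: (repr x) (repr y) (repr z) => u v w.
rewrite -(pi_qmul v w) -(pi_qmul u v) -(pi_qmul u) -(pi_qmul _ w).
by rewrite mulgA.
Qed.

HB.instance Definition _ := isSemigroup.Build wquot qmulA.

End QuotientSemigroup.

(* A congruence whose (finite) quotient belongs to [V]; as [V] is closed under
   isomorphism, this is expressed by an isomorphism with a member of [V]. *)
Record vcongruence (V : pseudovariety) (A : finType) := VCongruence {
  vcong :> congruence A;
  vcong_in : exists (S : finSemigroupType) (f : {multiplicative wquot vcong -> S}),
    V S /\ bijective f }.

HB.instance Definition _ V A := gen_eqMixin (vcongruence V A).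

Section ProV.
Variables (V : pseudovariety) (A : finType).

Definition wquot_product :=
  prod_topology (fun r : vcongruence V A => discrete_topology (wquot r)).

(* Compatibility with the canonical projections [A^+/r -> A^+/r'] for [r]
   contained in [r']. *)
Definition compatible : set wquot_product :=
  [set x | forall r r' : vcongruence V A, (forall u v, r u v -> r' u v) ->
     x r' = \pi_(wquot r') (repr (x r : wquot r))].

Definition profree : Type := compatible.

HB.instance Definition _ := Topological.copy profree compatible.

End ProV.

Section TopologyFacts.

Lemma closed_eq_continuous (X Y : topologicalType) (f g : X -> Y) :
  hausdorff_space Y -> continuous f -> continuous g -> closed [set x | f x = g x].
Proof.
move=> hY cf cg x clx; apply: hY => B C Bfx Cgx.
have [y [/= fgy [By Cy]]] :
    [set x | f x = g x] `&` ((f @^-1` B) `&` (g @^-1` C)) !=set0.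
  by apply: clx; apply: filterI; [exact: cf|exact: cg].
by exists (f y); split=> //; rewrite fgy.
Qed.

Lemma closed_preimage (X Y : topologicalType) (f : X -> Y) (A : set Y) :
  continuous f -> closed A -> closed (f @^-1` A).
Proof. by move=> cf cA; apply: (@closed_comp _ _ f A) => // x _; exact: cf. Qed.

Lemma val_continuous (X : topologicalType) (A : set X) :
  continuous (fun x : A => val x).
Proof. exact: (@initial_continuous _ _ (@set_val _ A)). Qed.

Lemma continuous_to_set_type (X Y : topologicalType) (A : set X) (f : Y -> A) :
  continuous (fun y => val (f y)) -> continuous f.
Proof. exact: (@continuous_comp_initial _ _ _ (@set_val _ A)). Qed.

Lemma compact_set_typeT (X : topologicalType) (A : set X) :
  compact A -> compact [set: A].
Proof.
move=> cA F FF _; have FA : (set_val @ F) A.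
  by apply: (@filterS _ F _ setT) => [x _|]; [exact: set_valP|exact: filterT].
have [p [Ap clp]] := cA (set_val @ F) _ FA.
exists (exist _ p (mem_set Ap)); split=> // B C FB [_ [[W oW <-]] /= Wp WC].
have FsB : (set_val @ F) (set_val @` B).
  by apply: (@filterS _ F _ B) => [y By|//] /=; exists y.
have [_ [[y By <-] Wy]] := clp (set_val @` B) W FsB (open_nbhs_nbhs (conj oW Wp)).
by exists y; split=> //; exact: WC.
Qed.

Lemma hausdorff_set_type (X : topologicalType) (A : set X) :
  hausdorff_space X -> hausdorff_space A.
Proof.
move=> hX x y xy; apply: val_inj; apply: hX => B C Bx Cy.
have [z [Bz Cz]] := xy (val @^-1` B) (val @^-1` C)
  (@val_continuous _ _ x _ Bx) (@val_continuous _ _ y _ Cy).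
by exists (val z).
Qed.

Lemma hausdorff_prod (X Y : topologicalType) :
  hausdorff_space X -> hausdorff_space Y -> hausdorff_space (X * Y)%type.
Proof.
move=> hX hY [x y] [x' y'] xy; congr (_, _).
  apply: hX => B C Bx Cx.
  have [[z t] /= [Bz Cz]] := xy (fst @^-1` B) (fst @^-1` C)
    (@cvg_fst _ _ _ _ _ _ Bx) (@cvg_fst _ _ _ _ _ _ Cx).
  by exists z.
apply: hY => B C By Cy.
have [[z t] /= [Bz Cz]] := xy (snd @^-1` B) (snd @^-1` C)
  (@cvg_snd _ _ _ _ _ _ By) (@cvg_snd _ _ _ _ _ _ Cy).
by exists t.
Qed.

Lemma continuous_pairing (X Y Z : topologicalType) (f : X -> Y) (g : X -> Z) :
  continuous f -> continuous g -> continuous (fun x => (f x, g x)).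
Proof. by move=> cf cg x; apply: cvg_pair; [exact: cf|exact: cg]. Qed.

Lemma continuous_comp_fun (X Y Z : topologicalType) (f : X -> Y) (g : Y -> Z) :
  continuous f -> continuous g -> continuous (fun x => g (f x)).
Proof. by move=> cf cg x; apply: continuous_comp; [exact: cf|exact: cg]. Qed.

Lemma fst_continuous (X Y : topologicalType) : continuous (@fst X Y).
Proof. by move=> x; exact: cvg_fst. Qed.

Lemma snd_continuous (X Y : topologicalType) : continuous (@snd X Y).
Proof. by move=> x; exact: cvg_snd. Qed.

Lemma cst_continuousT (X Y : topologicalType) (y : Y) :
  continuous (fun _ : X => y).
Proof. by move=> x; exact: cvg_cst. Qed.

Lemma continuous_to_prod (X : topologicalType) (I : Type)
  (T : I -> topologicalType) (f : X -> prod_topology T) :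
  (forall i, continuous (fun x => f x i)) -> continuous f.
Proof.
move=> cf x; apply/cvg_sup => i.
exact: (@continuous_comp_initial _ _ _ (fun g : prod_topology T => g i)
  f (cf i) x).
Qed.

Lemma proj_continuousT (I : eqType) (T : I -> topologicalType) i :
  continuous (fun f : prod_topology T => f i).
Proof. exact: (@proj_continuous I T i). Qed.

End TopologyFacts.

HB.mixin Record isCompactSemigroup S of Topological S & Semigroup S := {
  mul_continuous : continuous (fun xy : S * S => xy.1 * xy.2);
  compactT : compact [set: S];
  hausdorffT : hausdorff_space S }.

#[short(type="compactSemigroupType")]
HB.structure Definition CompactSemigroup :=
  {S of isCompactSemigroup S & Topological S & Semigroup S}.

Section ProVCompact.
Variables (V : pseudovariety) (A : finType).
Local Notation F := (profree V A).

Definition pcoord (r : vcongruence V A) (x : F) : discrete_topology (wquot r) :=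
  (val x : wquot_product V A) r.

Lemma pcoord_continuous r : continuous (@pcoord r).
Proof.
have h1 := (@val_continuous _ (@compatible V A)).
have h2 := (@proj_continuousT _ (fun r : vcongruence V A => discrete_topology (wquot r)) r).
have h := continuous_comp_fun h1 h2.
exact: h.
Qed.

Lemma profree_ext (x y : F) :
  (forall r : vcongruence V A, pcoord r x = pcoord r y) -> x = y.
Proof.
by move=> xy; apply: val_inj; apply: functional_extensionality_dep.
Qed.

Definition pmul_fun (x y : F) : wquot_product V A :=
  fun r => qmul (pcoord r x : wquot r) (pcoord r y).

Lemma pmul_subproof (x y : F) : pmul_fun x y \in @compatible V A.
Proof.
apply/mem_set => r r' rr'.
have hx : pcoord r' x = \pi_(wquot r') (repr (pcoord r x : wquot r)).
  exact: set_valP x r r' rr'.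
have hy : pcoord r' y = \pi_(wquot r') (repr (pcoord r y : wquot r)).
  exact: set_valP y r r' rr'.
rewrite /pmul_fun hx hy -pi_qmul; apply/pi_eqP/rr'/pi_eqP.
by rewrite reprK.
Qed.

Definition pmul (x y : F) : F :=
  exist (fun z => z \in @compatible V A) (pmul_fun x y) (pmul_subproof x y).

Lemma pmulA : associative pmul.
Proof.
move=> x y z; apply: profree_ext => r; exact: (@qmulA A (vcong r)).
Qed.

HB.instance Definition _ := isSemigroup.Build F pmulA.

Lemma pmul_continuous : continuous (fun xy : F * F => xy.1 * xy.2).
Proof.
apply: continuous_to_set_type; apply: continuous_to_prod => r [x y] /=.
apply/discrete_cvg => /=.
have cx : \forall z \near (x, y), pcoord r z.1 = pcoord r x.
  apply: (@cvg_fst F F (nbhs x) (nbhs y) _ [set z | pcoord r z = pcoord r x]).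
  apply: (@pcoord_continuous r x [set pcoord r x]); exact: discrete_set1.
have cy : \forall z \near (x, y), pcoord r z.2 = pcoord r y.
  apply: (@cvg_snd F F (nbhs x) (nbhs y) _ [set z | pcoord r z = pcoord r y]).
  apply: (@pcoord_continuous r y [set pcoord r y]); exact: discrete_set1.
near=> z; apply: (congr2 (@qmul A (vcong r))); by near: z.
Unshelve. all: by end_near. Qed.

Lemma wquot_finite (r : vcongruence V A) : finite_set [set: wquot r].
Proof.
have [S [f [_ /bij_inj finj]]] := vcong_in r.
rewrite -[setT](preimage_setT f); apply: finite_preimage.
  by move=> x y _ _; exact: finj.
exact: finite_finset.
Qed.

Lemma profree_closed : closed (@compatible V A).
Proof.
have -> : @compatible V A = \bigcap_(p in
    [set p : vcongruence V A * vcongruence V A | forall u v, p.1 u v -> p.2 u v])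
    [set x : wquot_product V A |
      x p.2 = \pi_(wquot p.2) (repr (x p.1 : wquot p.1))].
  apply/seteqP; split=> [x cx [r r'] /= rr'|x cx r r' rr']; first exact: cx.
  exact: (cx (r, r') rr').
apply: closed_bigI => -[r r'] /= _.
apply: (@closed_eq_continuous _ (discrete_topology (wquot r'))).
- exact: discrete_hausdorff.
- exact: proj_continuousT.
- have h1 := @proj_continuousT _
    (fun r : vcongruence V A => discrete_topology (wquot r)) r.
  have h2 : continuous ((fun y => \pi_(wquot r') (repr (y : wquot r))) :
      discrete_topology (wquot r) -> discrete_topology (wquot r')).
    move=> y; apply/discrete_cvg.
    by apply: (@filterS _ (nbhs y) _ [set y]) => [z ->//|]; exact: discrete_set1.
  have h := continuous_comp_fun h1 h2; exact: h.
Qed.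

Lemma wquot_product_compact : compact [set: wquot_product V A].
Proof.
have := @tychonoff _ (fun r : vcongruence V A => discrete_topology (wquot r))
  (fun=> setT) (fun r =>
  @finite_compact (discrete_topology (wquot r)) _ (wquot_finite r)).
by congr compact; apply/seteqP; split.
Qed.

Lemma profree_compact : compact [set: F].
Proof.
apply: compact_set_typeT.
exact: subclosed_compact profree_closed wquot_product_compact _.
Qed.

Lemma profree_hausdorff : hausdorff_space F.
Proof.
apply: hausdorff_set_type; apply: hausdorff_product => r.
exact: discrete_hausdorff.
Qed.

HB.instance Definition _ :=
  isCompactSemigroup.Build F pmul_continuous profree_compact profree_hausdorff.

End ProVCompact.

Section KernelCongruence.
Variables (A T : finType) (f : word A -> T).
Hypothesis fM : forall u u' v v' : word A,
  f u = f u' -> f v = f v' -> f (u * v) = f (u' * v').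

Definition ker_rel : rel (word A) := [rel u v | f u == f v].

Lemma ker_refl : reflexive ker_rel. Proof. by move=> u; exact: eqxx. Qed.
Lemma ker_sym : symmetric ker_rel. Proof. by move=> u v; exact: eq_sym. Qed.
Lemma ker_trans : transitive ker_rel.
Proof. by rewrite /ker_rel => v u w /= /eqP -> /eqP ->; exact: eqxx. Qed.

Definition ker_cong_subdef := EquivRel ker_rel ker_refl ker_sym ker_trans.

Lemma ker_congM (u u' v v' : word A) : ker_cong_subdef u u' ->
  ker_cong_subdef v v' -> ker_cong_subdef (u * v) (u' * v').
Proof. by move=> /eqP uu' /eqP vv'; apply/eqP; exact: fM. Qed.

Definition ker_cong : congruence A := Congruence ker_congM.

End KernelCongruence.

(* [fM] is a phantom parameter: it keys the multiplication, under which the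
   image of [f] is isomorphic to the quotient of [A^+] by the kernel of [f]. *)
Definition fimg (A T : finType) (f : word A -> T)
    (fM : forall u u' v v' : word A,
      f u = f u' -> f v = f v' -> f (u * v) = f (u' * v')) : Type :=
  {x : T | `[< exists w, f w = x >]}.

Section FiniteImage.
Variables (A T : finType) (f : word A -> T).
Hypothesis fM : forall u u' v v' : word A,
  f u = f u' -> f v = f v' -> f (u * v) = f (u' * v').

HB.instance Definition _ := Finite.copy (fimg fM)
  {x : T | `[< exists w, f w = x >]}.

Definition frep (x : fimg fM) : word A := projT1 (cid (asboolW (proj2_sig x))).

Lemma frepK x : f (frep x) = proj1_sig x.
Proof. exact: projT2 (cid (asboolW (proj2_sig x))). Qed.

Definition fcls (w : word A) : fimg fM :=
  exist _ (f w) (asboolT (ex_intro (fun w' => f w' = f w) w erefl)).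

Lemma fcls_eq u v : fcls u = fcls v <-> f u = f v.
Proof.
split; first by move=> /(congr1 (@proj1_sig _ _)).
by move=> fuv; apply: eq_exist.
Qed.

Lemma fclsK x : fcls (frep x) = x.
Proof. by case: x => x px; apply: eq_exist; rewrite frepK. Qed.

Definition fmul (x y : fimg fM) : fimg fM := fcls (frep x * frep y).

Lemma fclsM u v : fcls (u * v) = fmul (fcls u) (fcls v).
Proof.
by apply/fcls_eq; apply: fM; rewrite frepK.
Qed.

Lemma fmulA : associative fmul.
Proof.
move=> x y z; rewrite -[x]fclsK -[y]fclsK -[z]fclsK.
move: (frep x) (frep y) (frep z) => u v w.
rewrite -(fclsM v w) -(fclsM u v) -(fclsM u) -(fclsM _ w).
by rewrite mulgA.
Qed.

HB.instance Definition _ := isSemigroup.Build (fimg fM) fmulA.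

Lemma fcls_mul u v : fcls (u * v) = fcls u * fcls v.
Proof. exact: fclsM. Qed.

Definition fiso (x : wquot (ker_cong fM)) : fimg fM := fcls (repr x).

Lemma fiso_pi w : fiso (\pi_(wquot (ker_cong fM)) w) = fcls w.
Proof.
apply/fcls_eq/eqP; rewrite -/(ker_rel f _ _).
suff: ker_cong fM (repr (\pi_(wquot (ker_cong fM)) w)) w by [].
by apply/pi_eqP; rewrite reprK.
Qed.

Lemma fisoM (x y : wquot (ker_cong fM)) : fiso (x * y) = fiso x * fiso y.
Proof. by rewrite fiso_pi fclsM. Qed.

HB.instance Definition _ := isMultiplicative.Build _ _ fiso fisoM.

Lemma fiso_bij : bijective fiso.
Proof.
exists (fun x => \pi_(wquot (ker_cong fM)) (frep x)).
  move=> x; rewrite -[RHS]reprK; apply/pi_eqP/eqP.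
  by rewrite frepK.
by move=> x; rewrite fiso_pi fclsK.
Qed.

Lemma ker_vcong (V : pseudovariety) : V (fimg fM : finSemigroupType) ->
  exists r : vcongruence V A, forall u v, r u v <-> f u = f v.
Proof.
move=> Vf.
have h : exists (S : finSemigroupType)
    (g : {multiplicative wquot (ker_cong fM) -> S}), V S /\ bijective g.
  by exists (fimg fM : finSemigroupType), fiso; split=> //; exact: fiso_bij.
by exists (VCongruence h) => u v; split=> /eqP.
Qed.

End FiniteImage.

Section KernelOfMorphism.
Variables (V : pseudovariety) (A : finType) (S : finSemigroupType).
Variable f : {multiplicative word A -> S}.

Lemma mul_fM (u u' v v' : word A) :
  f u = f u' -> f v = f v' -> f (u * v) = f (u' * v').
Proof. by rewrite !gmulfM => -> ->. Qed.

Definition fval (x : fimg mul_fM) : S := proj1_sig x.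

Lemma fvalM (x y : fimg mul_fM) : fval (x * y) = fval x * fval y.
Proof. by rewrite {1}/fval /= gmulfM !frepK. Qed.

HB.instance Definition _ := isMultiplicative.Build _ _ fval fvalM.

Lemma mul_vcong : V S ->
  exists r : vcongruence V A, forall u v, r u v <-> f u = f v.
Proof.
move=> VS; apply: (ker_vcong (fM := mul_fM)).
apply: (pv_sub (pvP V) (f := fval)) VS.
by move=> [x px] [y py] /= xy; apply: eq_exist.
Qed.

End KernelOfMorphism.

Definition trivial_semigroup : Type := unit.
HB.instance Definition _ := Finite.copy trivial_semigroup unit.
Lemma trivial_mulA :
  associative (fun _ _ : trivial_semigroup => tt : trivial_semigroup).
Proof. by []. Qed.
HB.instance Definition _ := isSemigroup.Build trivial_semigroup trivial_mulA.

Section Directed.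
Variables (V : pseudovariety) (A : finType).

Definition triv_mor (w : word A) : trivial_semigroup := tt.
Lemma triv_morM u v : triv_mor (u * v) = triv_mor u * triv_mor v.
Proof. by []. Qed.
HB.instance Definition _ := isMultiplicative.Build _ _ triv_mor triv_morM.

Lemma vcongruence_inhabited : inhabited (vcongruence V A).
Proof.
have [|r _] := @mul_vcong V A (trivial_semigroup : finSemigroupType) triv_mor.
  by apply: (pv_triv (pvP V)); rewrite card_unit.
by constructor.
Qed.

Section Pair.
Variables (S S' : finSemigroupType) (r r' : congruence A).
Variables (f : {multiplicative wquot r -> S}) (f' : {multiplicative wquot r' -> S'}).
Definition pair_mor (w : word A) : (S * S')%type :=
  (f (\pi_(wquot r) w), f' (\pi_(wquot r') w)).
Lemma pair_morM u v : pair_mor (u * v) = pair_mor u * pair_mor v.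
Proof. by rewrite /pair_mor !pi_qmul !gmulfM. Qed.
HB.instance Definition _ := isMultiplicative.Build _ _ pair_mor pair_morM.
End Pair.

Lemma vcongruence_meet (r r' : vcongruence V A) :
  exists s : vcongruence V A,
    (forall u v, s u v -> r u v) /\ (forall u v, s u v -> r' u v).
Proof.
have [S [f [VS /bij_inj finj]]] := vcong_in r.
have [S' [f' [VS' /bij_inj finj']]] := vcong_in r'.
have [|s sP] := @mul_vcong V A (S * S')%type (pair_mor f f').
  exact: (pv_prod (pvP V)).
by exists s; split=> u v /sP [] => [/finj /pi_eqP|_ /finj' /pi_eqP].
Qed.

Local Notation F := (profree V A).

Lemma pcoord_mono (r s : vcongruence V A) (x y : F) :
  (forall u v, s u v -> r u v) -> pcoord s x = pcoord s y ->
  pcoord r x = pcoord r y.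
Proof.
move=> sr xy.
have hx : pcoord r x = \pi_(wquot r) (repr (pcoord s x : wquot s)).
  exact: set_valP x s r sr.
have hy : pcoord r y = \pi_(wquot r) (repr (pcoord s y : wquot s)).
  exact: set_valP y s r sr.
by rewrite hx hy xy.
Qed.

Lemma profree_nbhs (x : F) (U : set F) : nbhs x U ->
  exists r : vcongruence V A, forall y, pcoord r y = pcoord r x -> U y.
Proof.
pose G : set_system F := filter_from [set: vcongruence V A]
  (fun r => [set y | pcoord r y = pcoord r x]).
have FG : Filter G.
  apply: filter_from_filter.
    by have [r] := vcongruence_inhabited; exists r.
  move=> r r' _ _; have [s [sr sr']] := vcongruence_meet r r'.
  by exists s => // y /= ys; split; apply: pcoord_mono ys.
suff Gx : G --> x by move=> /Gx [r _ rU]; exists r => y; exact: rU.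
have Gvx : (val @ G) --> (val x : wquot_product V A).
  apply/cvg_sup => r B [_ [[W oW <-] /= Wx WB]].
  apply: (@filterS _ (val @ G) _ _ _ WB).
  by exists r => //= y /= yx; rewrite -/(pcoord r y) yx.
move=> B [_ [[W oW <-] /= Wx WB]].
by apply: (@filterS _ G _ _ _ WB); apply: Gvx; exact: open_nbhs_nbhs.
Qed.

Definition incl_fun (w : word A) : wquot_product V A :=
  fun r => \pi_(wquot r) w.

Lemma incl_subproof (w : word A) : incl_fun w \in @compatible V A.
Proof.
apply/mem_set => r r' rr'; apply/pi_eqP/rr'/pi_eqP.
by rewrite reprK.
Qed.

Definition incl (w : word A) : F :=
  exist (fun z => z \in @compatible V A) (incl_fun w) (incl_subproof w).

Lemma inclM (u v : word A) : incl (u * v) = incl u * incl v.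
Proof. by apply: profree_ext => r; exact: (@pi_qmul A (vcong r)). Qed.

End Directed.

Section Infix.
Variable A : eqType.
Implicit Types x y z u v w : seq A.

Lemma take_cat_take n u v : take n (u ++ v) = take n (take n u ++ take n v).
Proof.
have [nu|un] := ltnP n (size u).
  by rewrite takel_cat ?(ltnW nu)// takel_cat ?take_takel ?size_takel ?(ltnW nu)//.
rewrite (take_oversize un) !take_cat ltnNge un /=.
by rewrite take_takel ?leq_subr.
Qed.

Lemma prefix_take n z u : size z <= n -> prefix z u = prefix z (take n u).
Proof.
move=> zn; rewrite !prefixE take_takel//.
Qed.

Lemma infix_cat z u v : infix z (u ++ v) ->
  [\/ infix z u, infix z v |
    exists z1 z2, [/\ z = z1 ++ z2, suffix z1 u & prefix z2 v]].
Proof.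
move=> /infixP[p [s e]].
have [up|pu] := leqP (size u) (size p).
  apply: Or32; apply/infixP; exists (drop (size u) p), s.
  have -> : v = drop (size u) (u ++ v) by rewrite drop_size_cat.
  by rewrite e drop_cat; case: ltngtP up => // -> _; rewrite subnn drop0 drop_size.
have eu : u = p ++ take (size u - size p) (z ++ s).
  have := congr1 (take (size u)) e.
  by rewrite take_size_cat// take_cat ltnNge (ltnW pu).
have ev : v = drop (size u - size p) (z ++ s).
  have := congr1 (drop (size u)) e.
  by rewrite drop_size_cat// drop_cat ltnNge (ltnW pu).
set k := size u - size p in eu ev.
have [zk|kz] := leqP (size z) k.
  apply: Or31; rewrite eu; apply: infix_catl.
  rewrite take_cat ltnNge zk /=; exact: prefix_infix.
apply: Or33; exists (take k z), (drop k z); split; first by rewrite cat_take_drop.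
  by rewrite eu takel_cat ?(ltnW kz)// suffix_suffix.
by rewrite ev drop_cat kz prefix_prefix.
Qed.

Lemma infix_mid z u w v : size z <= size w -> infix z (u ++ w ++ v) ->
  infix z (u ++ w) \/ infix z (w ++ v).
Proof.
move=> zw; rewrite catA => /infix_cat[|zv|]; first by left.
  by right; apply: infix_catl.
move=> [z1 [z2 [ez sz1 pz2]]]; right.
have {}sz1 : suffix z1 w.
  have z1w : size z1 <= size w.
    by apply: leq_trans zw; rewrite ez size_cat leq_addr.
  move: sz1; rewrite /suffix rev_cat !prefixE size_rev takel_cat ?size_rev//.
rewrite ez; have [s1 ->] := suffixP sz1; have [s2 ->] := prefixP pz2.
by apply/infixP; exists s1, s2; rewrite !catA.
Qed.

End Infix.

Section LocalSignature.
Variables (A : finType) (n : nat).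
Implicit Types u v w : word A.

Definition local_sig u : n.-bseq A * n.-bseq A * {set n.-bseq A} :=
  (insub_bseq n (take n u), insub_bseq n (take n (rev u)),
   [set x : n.-bseq A | infix x (wseq u)]%SET).

Lemma insub_bseq_inj (s t : seq A) : size s <= n -> size t <= n ->
  insub_bseq n s = insub_bseq n t -> s = t.
Proof.
by move=> sn tn /(congr1 val); rewrite /insub_bseq !insubdK.
Qed.

Lemma size_take_le (s : seq A) : size (take n s) <= n.
Proof. by rewrite size_take_min geq_minl. Qed.

Lemma local_sigP u v : local_sig u = local_sig v <->
  [/\ take n u = take n v, take n (rev u) = take n (rev v) &
      forall x : seq A, size x <= n -> infix x u = infix x v].
Proof.
split=> [[h1 h2 h3]|[h1 h2 h3]].
  split=> [||x xn]; [apply: insub_bseq_inj h1|apply: insub_bseq_inj h2|];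
    rewrite ?size_take_le//.
  move/setP: h3 => /(_ (Bseq xn)); by rewrite !inE.
rewrite /local_sig h1 h2; congr (_, _); apply/setP => x; rewrite !inE.
exact: h3 (size_bseq x).
Qed.

Lemma local_sigM u u' v v' : local_sig u = local_sig u' ->
  local_sig v = local_sig v' -> local_sig (u * v) = local_sig (u' * v').
Proof.
suff H (x : seq A) (a a' b b' : word A) :
    local_sig a = local_sig a' -> local_sig b = local_sig b' ->
    size x <= n -> infix x (wseq a ++ wseq b) -> infix x (wseq a' ++ wseq b').
  move=> ua vb; have [t1 r1 _] := (local_sigP _ _).1 ua.
  have [t2 r2 _] := (local_sigP _ _).1 vb.
  apply/local_sigP; split=> /=.
  - by rewrite take_cat_take t1 t2 -take_cat_take.
  - by rewrite !rev_cat take_cat_take r1 r2 -take_cat_take.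
  - by move=> x xn; apply/idP/idP; apply: H.
move=> /local_sigP[_ ra ia] /local_sigP[tb _ ib] xn.
move=> /infix_cat[xa|xb|[z1 [z2 [ex sz pz]]]].
- by apply: infix_catr; rewrite -ia.
- by apply: infix_catl; rewrite -ib.
have z1n : size z1 <= n by apply: leq_trans xn; rewrite ex size_cat leq_addr.
have z2n : size z2 <= n by apply: leq_trans xn; rewrite ex size_cat leq_addl.
have {}sz : suffix z1 (wseq a').
  by rewrite /suffix (@prefix_take _ n) ?size_rev// -ra -prefix_take ?size_rev.
have {}pz : prefix z2 (wseq b').
  by rewrite (@prefix_take _ n)// -tb -prefix_take.
rewrite ex; have [s1 ->] := suffixP sz; have [s2 ->] := prefixP pz.
by apply/infixP; exists s1, s2; rewrite !catA.
Qed.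

Fixpoint wpow w k : word A := if k is k'.+1 then w * wpow w k' else w.

Lemma size_wpow w k : k < size (wpow w k).
Proof.
have w0 : 0 < size w by case: w => [[]].
by elim: k => //= k IH; rewrite size_cat -addn1 addnC leq_add.
Qed.

Lemma LSl_local_sig : LSl (fimg local_sigM : finSemigroupType).
Proof.
move=> e ee; pose w := wpow (frep e) n.
have ew : e = fcls local_sigM w.
  suff: forall k, e = fcls local_sigM (wpow (frep e) k) by exact.
  elim=> [|k IH] /=; first by rewrite fclsK.
  by rewrite fclsM -IH fclsK -[LHS]ee.
have wn : n <= size w by exact: ltnW (size_wpow _ _).
have mulE (x y : fimg local_sigM) : (e * x * e) * (e * y * e) = e * x * e * y * e.
  by rewrite -!mulgA (mulgA e e) ee.
have pre (s t : seq A) : take n (wseq w ++ s) = take n (wseq w ++ t).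
  by rewrite !takel_cat.
have suf (s t : seq A) : take n (rev (s ++ wseq w)) = take n (rev (t ++ wseq w)).
  by rewrite !rev_cat !takel_cat ?size_rev.
have mid (u v : word A) (x : seq A) : size x <= n ->
    infix x (wseq w ++ wseq u ++ wseq w ++ wseq v ++ wseq w) =
    infix x (wseq w ++ wseq u ++ wseq w) || infix x (wseq w ++ wseq v ++ wseq w).
  move=> xn; apply/idP/orP.
    rewrite catA => /infix_mid[]; first exact: leq_trans wn.
      by rewrite -catA; left.
    by right.
  move=> [/infixP[p [s e1]]|h].
    apply/infixP; exists p, (s ++ wseq v ++ wseq w).
    by rewrite !catA -(catA _ x) -[p ++ (x ++ s)]e1 !catA.
  by rewrite catA; apply: infix_catl.
split=> [x y|x].
  rewrite !mulE -[x]fclsK -[y]fclsK ew.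
  move: (frep x) (frep y) => u v.
  have E u' v' : fcls local_sigM w * fcls local_sigM u' * fcls local_sigM w *
      fcls local_sigM v' * fcls local_sigM w =
      fcls local_sigM (w * (u' * (w * (v' * w)))).
    by rewrite !fcls_mul !mulgA.
  rewrite !E; apply/fcls_eq/local_sigP; split=> /= [||z zn].
  - exact: pre.
  - by rewrite !catA; exact: suf.
  - by rewrite !mid// orbC.
rewrite /idem mulE -[x]fclsK ew.
move: (frep x) => u.
have -> : fcls local_sigM w * fcls local_sigM u * fcls local_sigM w *
    fcls local_sigM u * fcls local_sigM w =
    fcls local_sigM (w * (u * (w * (u * w)))).
  by rewrite !fcls_mul !mulgA.
have -> : fcls local_sigM w * fcls local_sigM u * fcls local_sigM w =
    fcls local_sigM (w * (u * w)).
  by rewrite !fcls_mul !mulgA.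
apply/fcls_eq/local_sigP; split=> /= [||z zn].
- exact: pre.
- by rewrite !catA; exact: suf.
- by rewrite !mid// orbb.
Qed.

End LocalSignature.

Definition fullshift (A : finType) :=
  prod_topology (fun _ : int => discrete_topology A).

Definition shiftmap (A : finType) (x : fullshift A) : fullshift A :=
  fun i => x (i + 1)%R.

Record subshift (A : finType) := Subshift {
  subshift_set :> set (fullshift A);
  subshift_closed : closed subshift_set;
  subshift_nonempty : subshift_set !=set0;
  subshift_shift : @shiftmap A @` subshift_set = subshift_set }.

Definition occurs (A : finType) (w : word A) (x : fullshift A) : Prop :=
  exists i : int, wseq w = mkseq (fun j => x (i + j%:Z)%R) (size w).

Definition language (A : finType) (X : subshift A) : set (word A) :=
  [set w | exists2 x, subshift_set X x & occurs w x].

Definition conjugate (A B : finType) (X : subshift A) (Y : subshift B) : Prop :=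
  exists (f : fullshift A -> fullshift B) (g : fullshift B -> fullshift A),
    [/\ {within X, continuous f}, {within Y, continuous g},
        (forall x, subshift_set X x -> subshift_set Y (f x) /\ g (f x) = x),
        (forall y, subshift_set Y y -> subshift_set X (g y) /\ f (g y) = y) &
        (forall x, subshift_set X x -> f (shiftmap x) = shiftmap (f x))].

(* [option A] is [A] with a new letter: [None] plays the role of the diamond. *)
Definition expand_letter (A : finType) (alpha a : A) : seq (option A) :=
  if a == alpha then [:: Some a; None] else [:: Some a].

Lemma expand_subproof (A : finType) (alpha : A) (w : word A) :
  flatten [seq expand_letter alpha a | a <- wseq w] != [::].
Proof. by case: w => [[//|a s] _] /=; rewrite /expand_letter; case: ifP. Qed.

Definition expand (A : finType) (alpha : A) (w : word A) : word (option A) :=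
  Word (expand_subproof alpha w).

Lemma expandM (A : finType) (alpha : A) (u v : word A) :
  expand alpha (u * v) = expand alpha u * expand alpha v.
Proof. by apply: val_inj; rewrite /= map_cat flatten_cat. Qed.

Definition symbol_expansion (A : finType) (X : subshift A) (alpha : A)
    (X' : subshift (option A)) : Prop :=
  expand alpha @` language X `<=` language X' /\
  forall Y : subshift (option A),
    expand alpha @` language X `<=` language Y -> X' `<=` Y.

(* Conjugacy of suspension flows up to a time change, in the combinatorial form
   given by the theorem of Parry and Sullivan. *)
Inductive flow_equivalent :
    forall A B : finType, subshift A -> subshift B -> Prop :=
| flow_conjugate A B (X : subshift A) (Y : subshift B) :
    conjugate X Y -> flow_equivalent X Y
| flow_expansion A (X : subshift A) alpha (X' : subshift (option A)) :
    symbol_expansion X alpha X' -> flow_equivalent X X'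
| flow_refl A (X : subshift A) : flow_equivalent X X
| flow_sym A B (X : subshift A) (Y : subshift B) :
    flow_equivalent X Y -> flow_equivalent Y X
| flow_trans A B C (X : subshift A) (Y : subshift B) (Z : subshift C) :
    flow_equivalent X Y -> flow_equivalent Y Z -> flow_equivalent X Z.

Definition factor (S : semigroupType) (x y : S) : Prop :=
  [\/ y = x, exists a, y = a * x, exists b, y = x * b |
      exists a b, y = a * x * b].

Definition mirage (V : pseudovariety) (A : finType) (X : subshift A) :
    set (profree V A) :=
  [set u | forall w : word A, factor (incl V w) u -> language X w].

Arguments mirage V {A} X.

Section MirageFacts.
Variables (V : pseudovariety) (hLSl : forall S, LSl S -> V S).
Variable A : finType.
Local Notation F := (profree V A).

Lemma local_vcong n : exists r : vcongruence V A,
  forall u v, r u v <-> local_sig n u = local_sig n v.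
Proof. by apply: (ker_vcong (fM := @local_sigM A n)); exact/hLSl/LSl_local_sig. Qed.

Lemma infix_factor (w v : word A) : infix (wseq w) (wseq v) -> factor w v.
Proof.
move=> /infixP[p [s e]].
case: p e => [|a p] e; case: s e => [|b s] e.
- by apply: Or41; apply: val_inj; rewrite /= e cats0.
- apply: Or43; exists (@Word A (b :: s) erefl); exact: val_inj.
- apply: Or42; exists (@Word A (a :: p) erefl); apply: val_inj.
  by rewrite /= e cats0.
- apply: Or44; exists (@Word A (a :: p) erefl), (@Word A (b :: s) erefl).
  by apply: val_inj; rewrite /= e -?catA.
Qed.

Lemma factor_incl (w v : word A) : factor w v -> factor (incl V w) (incl V v).
Proof.
case=> [->|[a ->]|[b ->]|[a [b ->]]]; rewrite ?inclM.
- by apply: Or41.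
- by apply: Or42; exists (incl V a).
- by apply: Or43; exists (incl V b).
- by apply: Or44; exists (incl V a), (incl V b).
Qed.

Lemma mul_pair_continuous (X : topologicalType) (f g : X -> F) :
  continuous f -> continuous g -> continuous (fun x => f x * g x).
Proof.
move=> cf cg.
exact: (continuous_comp_fun (continuous_pairing cf cg) (@mul_continuous F)).
Qed.

Lemma closed_range (X : topologicalType) (f : X -> F) :
  compact [set: X] -> continuous f -> closed (range f).
Proof.
move=> cX cf; apply: compact_closed; first exact: hausdorffT.
by apply: continuous_compact => //; apply: continuous_subspaceT.
Qed.

Lemma closed_factor (x : F) : closed [set u | factor x u].
Proof.
have -> : [set u | factor x u] = (range (fun _ : F => x)) `|`
    (range (fun a => a * x)) `|` (range (fun b => x * b)) `|`
    (range (fun ab : F * F => ab.1 * x * ab.2)).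
  apply/seteqP; split=> u.
    case=> [->|[a ->]|[b ->]|[a [b ->]]].
    - by left; left; left; exists x.
    - by left; left; right; exists a.
    - by left; right; exists b.
    - by right; exists (a, b).
  case=> [[[[_ _ <-]|[a _ <-]]|[b _ <-]]|[[a b] _ <-]].
  - exact: Or41.
  - by apply: Or42; exists a.
  - by apply: Or43; exists b.
  - by apply: Or44; exists a, b.
have cst (X : topologicalType) := @cst_continuousT X F x.
have idc : continuous (id : F -> F) by move=> y; exact: cvg_id.
have cF := @compactT F.
apply: closedU; [apply: closedU; [apply: closedU|]|]; apply: closed_range => //.
- exact: mul_pair_continuous.
- exact: mul_pair_continuous.
- by rewrite -setXTT; exact: compact_setX.
- apply: mul_pair_continuous; last exact: snd_continuous.
  by apply: mul_pair_continuous => //; exact: fst_continuous.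
Qed.

Lemma infix_local n (r : vcongruence V A) (u v w : word A) :
  (forall u v, r u v <-> local_sig n u = local_sig n v) -> size w <= n ->
  \pi_(wquot r) u = \pi_(wquot r) v -> infix w u = infix w v.
Proof. by move=> rP wn /pi_eqP /rP /local_sigP[_ _]; exact. Qed.

Lemma factor_inclP n (r : vcongruence V A) (u : F) (v w : word A) :
  (forall u v, r u v <-> local_sig n u = local_sig n v) -> size w <= n ->
  pcoord r u = \pi_(wquot r) v -> factor (incl V w) u <-> infix w v.
Proof.
move=> rP wn uv; split.
  have coord (a : F) : pcoord r a = \pi_(wquot r) (repr (pcoord r a : wquot r)).
    by rewrite reprK.
  have inf (t : word A) : pcoord r u = \pi_(wquot r) t -> infix w t -> infix w v.
    by rewrite uv => /(infix_local rP wn) ->.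
  case=> [e|[a e]|[b e]|[a [b e]]].
  - by apply: (inf w); [rewrite e|exact: infix_refl].
  - apply: (inf (repr (pcoord r a : wquot r) * w)); last exact: suffix_infix.
    by rewrite e pi_qmul -coord.
  - apply: (inf (w * repr (pcoord r b : wquot r))); last exact: prefix_infix.
    by rewrite e pi_qmul -coord.
  - apply: (inf (repr (pcoord r a : wquot r) * w * repr (pcoord r b : wquot r))).
      by rewrite e !pi_qmul -!coord.
    by rewrite /= -catA; exact: infix_infix.
move=> wv; apply: contrapT => nwu.
have [r' r'P] := @profree_nbhs V A u (~` [set u | factor (incl V w) u])
  (open_nbhs_nbhs (conj (closed_openC (@closed_factor (incl V w))) nwu)).
have [s [sr sr']] := vcongruence_meet r r'.
pose t : word A := repr (pcoord s u : wquot s).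
have st : pcoord s (incl V t) = pcoord s u by exact: reprK.
apply: (r'P (incl V t)); first exact: pcoord_mono sr' st.
apply/factor_incl/infix_factor.
rewrite (@infix_local n r t v w rP wn) // -uv.
exact: pcoord_mono sr st.
Qed.

Lemma mirage_closed (X : subshift A) : closed (mirage V X).
Proof.
have -> : mirage V X = \bigcap_(w in ~` language X)
    (~` [set u | factor (incl V w) u]).
  apply/seteqP; split=> [u Mu w /= nw wu|u Mu w wu]; first exact/nw/Mu.
  by apply: contrapT => nw; exact: (Mu w nw wu).
apply: closed_bigI => w _.
have [r rP] := local_vcong (size w).
have -> : ~` [set u | factor (incl V w) u] =
    pcoord r @^-1` [set x | ~ infix w (repr (x : wquot r))].
  by apply/seteqP; split=> u /=; apply: contra_not;
    rewrite (@factor_inclP _ _ _ (repr (pcoord r u : wquot r)) _ rP) ?reprK.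
apply: closed_preimage; first exact: pcoord_continuous.
exact: (@discrete_closed (discrete_topology (wquot r))).
Qed.

Lemma mirage_mulWl (X : subshift A) (x y : F) :
  mirage V X (x * y) -> mirage V X x.
Proof.
move=> My w wx; apply: My; case: wx => [->|[a ->]|[b ->]|[a [b ->]]].
- by apply: Or43; exists y.
- by apply: Or44; exists a, y.
- by apply: Or43; exists (b * y); rewrite mulgA.
- by apply: Or44; exists a, (b * y); rewrite !mulgA.
Qed.

Lemma mirage_mulWr (X : subshift A) (x y : F) :
  mirage V X (x * y) -> mirage V X y.
Proof.
move=> My w wx; apply: My; case: wx => [->|[a ->]|[b ->]|[a [b ->]]].
- by apply: Or42; exists x.
- by apply: Or42; exists (x * a); rewrite mulgA.
- by apply: Or44; exists x, b; rewrite mulgA.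
- by apply: Or44; exists (x * a), b; rewrite !mulgA.
Qed.

Lemma mirage_mul (X : subshift A) (u f v : F) : idem f -> u * f = u ->
  f * v = v -> mirage V X u -> mirage V X v -> mirage V X (u * v).
Proof.
move=> ff uf fv Mu Mv w.
have [r rP] := local_vcong (size w).
have coord (a : F) : pcoord r a = \pi_(wquot r) (repr (pcoord r a : wquot r)).
  by rewrite reprK.
pose u0 : word A := repr (pcoord r u : wquot r).
pose v0 : word A := repr (pcoord r v : wquot r).
pose f0 : word A := repr (pcoord r f : wquot r).
have fk k : pcoord r f = \pi_(wquot r) (wpow f0 k).
  elim: k => [|k IH] /=; first exact: coord.
  by rewrite pi_qmul -IH -coord -[in LHS]ff.
have ufE : pcoord r u = \pi_(wquot r) (u0 * wpow f0 (size w)).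
  by rewrite pi_qmul -fk -coord -[in LHS]uf.
have fvE : pcoord r v = \pi_(wquot r) (wpow f0 (size w) * v0).
  by rewrite pi_qmul -fk -coord -[in LHS]fv.
have uvE : pcoord r (u * v) = \pi_(wquot r) (u0 * (wpow f0 (size w) * v0)).
  by rewrite pi_qmul -fvE -coord.
move=> /(factor_inclP rP (leqnn _) uvE) /= /infix_mid[].
- exact: ltnW (size_wpow _ _).
- by move=> /(factor_inclP rP (leqnn _) ufE); exact: Mu.
- by move=> /(factor_inclP rP (leqnn _) fvE); exact: Mv.
Qed.

End MirageFacts.

(* Small categories presented by their arrows; [ccomp f g] is the composite
   "[f] after [g]", defined when [dom f = cod g]. *)
Record compactCategory := CompactCategory {
  ob : topologicalType;
  arr : topologicalType;
  dom : arr -> ob;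
  cod : arr -> ob;
  idc : ob -> arr;
  ccomp : forall f g : arr, dom f = cod g -> arr;
  dom_id : forall c, dom (idc c) = c;
  cod_id : forall c, cod (idc c) = c;
  dom_comp : forall f g (p : dom f = cod g), dom (ccomp p) = dom g;
  cod_comp : forall f g (p : dom f = cod g), cod (ccomp p) = cod f;
  comp1c : forall f, ccomp (dom_id (cod f)) = f;
  compc1 : forall f, ccomp (esym (cod_id (dom f))) = f;
  compA : forall f g h (p : dom f = cod g) (q : dom g = cod h),
    ccomp (etrans (dom_comp p) q) = ccomp (etrans p (esym (cod_comp q)));
  ob_compact : compact [set: ob];
  ob_hausdorff : hausdorff_space ob;
  arr_compact : compact [set: arr];
  arr_hausdorff : hausdorff_space arr;
  dom_continuous : continuous dom;
  cod_continuous : continuous cod;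
  id_continuous : continuous idc;
  comp_continuous : continuous
    (fun fg : [set fg : arr * arr | dom fg.1 = cod fg.2] => ccomp (set_valP fg)) }.

Arguments ccomp {_} [f g] p.
Arguments idc {_} _.

Lemma comp_congr (C : compactCategory) (f f' g g' : arr C)
  (p : dom f = cod g) (p' : dom f' = cod g') :
  f = f' -> g = g' -> ccomp p = ccomp p'.
Proof. by move=> ff' gg'; subst; rewrite (Prop_irrelevance p p'). Qed.

Record continuousFunctor (C D : compactCategory) := ContinuousFunctor {
  fob : ob C -> ob D;
  farr : arr C -> arr D;
  farr_dom : forall f, dom (farr f) = fob (dom f);
  farr_cod : forall f, cod (farr f) = fob (cod f);
  farr_id : forall c, farr (idc c) = idc (fob c);
  farr_comp : forall f g (p : dom f = cod g),
    exists q : dom (farr f) = cod (farr g), farr (ccomp p) = ccomp q;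
  fob_continuous : continuous fob;
  farr_continuous : continuous farr }.

Definition id_functor (C : compactCategory) : continuousFunctor C C.
Proof.
apply: (@ContinuousFunctor C C id id) => //.
- by move=> f g p; exists p.
- by move=> x; exact: cvg_id.
- by move=> x; exact: cvg_id.
Defined.

Definition comp_functor (C D E : compactCategory)
  (G : continuousFunctor D E) (F : continuousFunctor C D) :
  continuousFunctor C E.
Proof.
apply: (@ContinuousFunctor C E (fun c => fob G (fob F c))
  (fun f => farr G (farr F f))).
- by move=> f; rewrite !farr_dom.
- by move=> f; rewrite !farr_cod.
- by move=> c; rewrite !farr_id.
- move=> f g p; have [q ->] := farr_comp F p.
  exact: (farr_comp G q).
- exact: continuous_comp_fun (@fob_continuous _ _ F) (@fob_continuous _ _ G).
- exact: continuous_comp_fun (@farr_continuous _ _ F) (@farr_continuous _ _ G).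
Defined.

Definition is_iso (C : compactCategory) (f : arr C) : Prop :=
  exists (g : arr C) (p : dom f = cod g) (q : dom g = cod f),
    ccomp p = idc (cod f) /\ ccomp q = idc (dom f).

Definition continuously_isomorphic (C D : compactCategory)
    (F G : continuousFunctor C D) : Prop :=
  exists eta : ob C -> arr D,
    [/\ continuous eta,
        forall c, dom (eta c) = fob F c /\ cod (eta c) = fob G c,
        forall c, is_iso (eta c) &
        forall f : arr C,
          exists (p : dom (eta (cod f)) = cod (farr F f))
                 (q : dom (farr G f) = cod (eta (dom f))), ccomp p = ccomp q].

Definition continuously_equivalent (C D : compactCategory) : Prop :=
  exists (F : continuousFunctor C D) (G : continuousFunctor D C),
    continuously_isomorphic (comp_functor F G) (id_functor D) /\
    continuously_isomorphic (comp_functor G F) (id_functor C).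

Section Karoubi.
Variable S : compactSemigroupType.

Definition kob : set S := [set e | idem e].

(* The arrow [(e, s, f) : f -> e] is encoded as [((e, s), f)]. *)
Definition karr : set (S * S * S) :=
  [set x | [/\ idem x.1.1, idem x.2 & x.1.2 = x.1.1 * x.1.2 * x.2]].

Definition kdom (x : karr) : kob :=
  exist (fun e => e \in kob) (val x).2 (mem_set (let: And3 _ h _ := set_valP x in h)).

Definition kcod (x : karr) : kob :=
  exist (fun e => e \in kob) (val x).1.1
    (mem_set (let: And3 h _ _ := set_valP x in h)).

Lemma kid_subproof (e : kob) : karr (val e, val e, val e).
Proof. by have ee := set_valP e; split=> //=; rewrite !ee. Qed.

Definition kid (e : kob) : karr :=
  exist (fun x => x \in karr) _ (mem_set (kid_subproof e)).

Lemma karrl (x : karr) : (val x).1.1 * (val x).1.2 = (val x).1.2.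
Proof. by have [ee _ e] := set_valP x; rewrite e !mulgA ee. Qed.

Lemma karrr (x : karr) : (val x).1.2 * (val x).2 = (val x).1.2.
Proof. by have [_ ff e] := set_valP x; rewrite e -!mulgA ff. Qed.

Lemma kcomp_subproof (x y : karr) : kdom x = kcod y ->
  karr ((val x).1.1, (val x).1.2 * (val y).1.2, (val y).2).
Proof.
move=> _; have [ee _ _] := set_valP x; have [_ ff _] := set_valP y.
by split=> //=; rewrite mulgA karrl -mulgA karrr.
Qed.

Definition kcomp (x y : karr) (p : kdom x = kcod y) : karr :=
  exist (fun x => x \in karr) _ (mem_set (kcomp_subproof p)).

Lemma kdom_id (e : kob) : kdom (kid e) = e.
Proof. exact: val_inj. Qed.

Lemma kcod_id (e : kob) : kcod (kid e) = e.
Proof. exact: val_inj. Qed.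

Lemma kdom_comp (x y : karr) (p : kdom x = kcod y) : kdom (kcomp p) = kdom y.
Proof. exact: val_inj. Qed.

Lemma kcod_comp (x y : karr) (p : kdom x = kcod y) : kcod (kcomp p) = kcod x.
Proof. exact: val_inj. Qed.

Lemma kcomp1c (x : karr) : kcomp (kdom_id (kcod x)) = x.
Proof.
apply: val_inj; apply: (etrans (_ : _ =
  ((val x).1.1, (val x).1.1 * (val x).1.2, (val x).2))) => //.
by rewrite karrl -!surjective_pairing.
Qed.

Lemma kcompc1 (x : karr) : kcomp (esym (kcod_id (kdom x))) = x.
Proof.
apply: val_inj; apply: (etrans (_ : _ =
  ((val x).1.1, (val x).1.2 * (val x).2, (val x).2))) => //.
by rewrite karrr -!surjective_pairing.
Qed.

Lemma kcompA (x y z : karr) (p : kdom x = kcod y) (q : kdom y = kcod z) :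
  kcomp (etrans (kdom_comp p) q) = kcomp (etrans p (esym (kcod_comp q))).
Proof. by apply: val_inj => /=; rewrite mulgA. Qed.

Lemma kmul_continuous (X : topologicalType) (f g : X -> S) :
  continuous f -> continuous g -> continuous (fun x => f x * g x).
Proof.
move=> cf cg.
exact: (continuous_comp_fun (continuous_pairing cf cg) (@mul_continuous S)).
Qed.

Let cid : continuous (id : S -> S). Proof. by move=> x; exact: cvg_id. Qed.

Let c11 : continuous (fun x : S * S * S => x.1.1).
Proof. exact: continuous_comp_fun (@fst_continuous _ _) (@fst_continuous _ _). Qed.

Let c12 : continuous (fun x : S * S * S => x.1.2).
Proof. exact: continuous_comp_fun (@fst_continuous _ _) (@snd_continuous _ _). Qed.

Let c2 : continuous (fun x : S * S * S => x.2).
Proof. exact: snd_continuous. Qed.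

Lemma kob_closed : closed kob.
Proof.
apply: closed_eq_continuous; [exact: hausdorffT| |exact: cid].
by apply: kmul_continuous; exact: cid.
Qed.

Lemma karr_closed : closed karr.
Proof.
have -> : karr = [set x | x.1.1 * x.1.1 = x.1.1] `&`
    ([set x | x.2 * x.2 = x.2] `&` [set x | x.1.2 = x.1.1 * x.1.2 * x.2]).
  by apply/seteqP; split=> x [? []]; split.
apply: closedI; [|apply: closedI]; apply: closed_eq_continuous => //;
  try exact: hausdorffT.
- exact: kmul_continuous.
- exact: kmul_continuous.
- by apply: kmul_continuous => //; exact: kmul_continuous.
Qed.

Lemma kob_compact : compact [set: kob].
Proof.
apply: compact_set_typeT.
exact: subclosed_compact kob_closed (@compactT S) _.
Qed.

Lemma karr_compact : compact [set: karr].
Proof.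
apply: compact_set_typeT.
have cT : compact [set: S * S * S].
  by rewrite -!setXTT; do 2! [apply: compact_setX; last exact: compactT];
    exact: compactT.
exact: subclosed_compact karr_closed cT _.
Qed.

Lemma kob_hausdorff : hausdorff_space kob.
Proof. exact/hausdorff_set_type/hausdorffT. Qed.

Lemma karr_hausdorff : hausdorff_space karr.
Proof.
apply: hausdorff_set_type.
by do 2! [apply: hausdorff_prod; last exact: hausdorffT]; exact: hausdorffT.
Qed.

Let cv : continuous (fun x : karr => val x).
Proof. exact: val_continuous. Qed.

Lemma kdom_continuous : continuous kdom.
Proof. apply: continuous_to_set_type; exact: (continuous_comp_fun cv c2). Qed.

Lemma kcod_continuous : continuous kcod.
Proof. apply: continuous_to_set_type; exact: (continuous_comp_fun cv c11). Qed.

Lemma kid_continuous : continuous kid.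
Proof.
apply: continuous_to_set_type.
have h : continuous (fun x : kob => val x) by exact: val_continuous.
exact: (continuous_pairing (continuous_pairing h h) h).
Qed.

Lemma kcomp_continuous : continuous
  (fun fg : [set fg : karr * karr | kdom fg.1 = kcod fg.2] => kcomp (set_valP fg)).
Proof.
apply: continuous_to_set_type.
have h := @val_continuous _ [set fg : karr * karr | kdom fg.1 = kcod fg.2].
have h1 := continuous_comp_fun (continuous_comp_fun h (@fst_continuous _ _)) cv.
have h2 := continuous_comp_fun (continuous_comp_fun h (@snd_continuous _ _)) cv.
have H := continuous_pairing (continuous_pairing (continuous_comp_fun h1 c11)
  (kmul_continuous (continuous_comp_fun h1 c12) (continuous_comp_fun h2 c12)))
  (continuous_comp_fun h2 c2).
exact: H.
Qed.

Definition karoubi : compactCategory :=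
  @CompactCategory kob karr kdom kcod kid kcomp kdom_id kcod_id kdom_comp
    kcod_comp kcomp1c kcompc1 kcompA kob_compact kob_hausdorff karr_compact
    karr_hausdorff kdom_continuous kcod_continuous kid_continuous
    kcomp_continuous.

End Karoubi.

Record closedSubcategory (C : compactCategory) := ClosedSubcategory {
  sub_ob : set (ob C);
  sub_arr : set (arr C);
  sub_dom : forall f, sub_arr f -> sub_ob (dom f);
  sub_cod : forall f, sub_arr f -> sub_ob (cod f);
  sub_id : forall c, sub_ob c -> sub_arr (idc c);
  sub_comp : forall f g (p : dom f = cod g),
    sub_arr f -> sub_arr g -> sub_arr (ccomp p);
  sub_ob_closed : closed sub_ob;
  sub_arr_closed : closed sub_arr }.

Section Subcategory.
Variables (C : compactCategory) (D : closedSubcategory C).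

Definition sob : topologicalType := sub_ob D.
Definition sarr : topologicalType := sub_arr D.

Definition sdom (f : sarr) : sob :=
  exist (fun c => c \in sub_ob D) (dom (val f)) (mem_set (sub_dom (set_valP f))).

Definition scod (f : sarr) : sob :=
  exist (fun c => c \in sub_ob D) (cod (val f)) (mem_set (sub_cod (set_valP f))).

Definition sid (c : sob) : sarr :=
  exist (fun f => f \in sub_arr D) (idc (val c)) (mem_set (sub_id (set_valP c))).

Definition scomp (f g : sarr) (p : sdom f = scod g) : sarr :=
  exist (fun f => f \in sub_arr D) (ccomp (congr1 val p))
    (mem_set (sub_comp (congr1 val p) (set_valP f) (set_valP g))).

Lemma sdom_id c : sdom (sid c) = c.
Proof. by apply: val_inj; exact: dom_id. Qed.

Lemma scod_id c : scod (sid c) = c.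
Proof. by apply: val_inj; exact: cod_id. Qed.

Lemma sdom_comp f g (p : sdom f = scod g) : sdom (scomp p) = sdom g.
Proof. by apply: val_inj; exact: dom_comp. Qed.

Lemma scod_comp f g (p : sdom f = scod g) : scod (scomp p) = scod f.
Proof. by apply: val_inj; exact: cod_comp. Qed.

Lemma scomp1c f : scomp (sdom_id (scod f)) = f.
Proof. by apply: val_inj; rewrite -[RHS]comp1c; exact: comp_congr. Qed.

Lemma scompc1 f : scomp (esym (scod_id (sdom f))) = f.
Proof. by apply: val_inj; rewrite -[RHS]compc1; exact: comp_congr. Qed.

Lemma scompA f g h (p : sdom f = scod g) (q : sdom g = scod h) :
  scomp (etrans (sdom_comp p) q) = scomp (etrans p (esym (scod_comp q))).
Proof.
apply: val_inj.
have := compA (congr1 val p) (congr1 val q).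
move=> e; apply: etrans (etrans _ e) _; exact: comp_congr.
Qed.

Lemma sob_compact : compact [set: sob].
Proof.
apply: compact_set_typeT.
exact: subclosed_compact (@sub_ob_closed C D) (@ob_compact C) _.
Qed.

Lemma sarr_compact : compact [set: sarr].
Proof.
apply: compact_set_typeT.
exact: subclosed_compact (@sub_arr_closed C D) (@arr_compact C) _.
Qed.

Lemma sob_hausdorff : hausdorff_space sob.
Proof. exact/hausdorff_set_type/ob_hausdorff. Qed.

Lemma sarr_hausdorff : hausdorff_space sarr.
Proof. exact/hausdorff_set_type/arr_hausdorff. Qed.

Let cob : continuous (fun x : sob => val x).
Proof. exact: val_continuous. Qed.

Let carr : continuous (fun x : sarr => val x).
Proof. exact: val_continuous. Qed.

Lemma sdom_continuous : continuous sdom.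
Proof.
apply: continuous_to_set_type.
exact: (continuous_comp_fun carr (@dom_continuous C)).
Qed.

Lemma scod_continuous : continuous scod.
Proof.
apply: continuous_to_set_type.
exact: (continuous_comp_fun carr (@cod_continuous C)).
Qed.

Lemma sid_continuous : continuous sid.
Proof.
apply: continuous_to_set_type.
exact: (continuous_comp_fun cob (@id_continuous C)).
Qed.

Lemma scomp_continuous : continuous
  (fun fg : [set fg : sarr * sarr | sdom fg.1 = scod fg.2] => scomp (set_valP fg)).
Proof.
apply: continuous_to_set_type.
pose E := [set fg : sarr * sarr | sdom fg.1 = scod fg.2].
pose E' := [set fg : arr C * arr C | dom fg.1 = cod fg.2].
have k_sub (fg : E) : E' (val (val fg).1, val (val fg).2).
  have e : sdom (val fg).1 = scod (val fg).2 := set_valP fg.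
  exact: (congr1 val e).
pose k (fg : E) : E' := exist (fun x => x \in E') _ (mem_set (k_sub fg)).
have h : continuous (fun x : E => val x) by exact: val_continuous.
have h1 := continuous_comp_fun (continuous_comp_fun h (@fst_continuous _ _)) carr.
have h2 := continuous_comp_fun (continuous_comp_fun h (@snd_continuous _ _)) carr.
have ck : continuous k.
  by apply: continuous_to_set_type; exact: (continuous_pairing h1 h2).
have H := continuous_comp_fun ck (@comp_continuous C).
have -> : (fun y : E => val (scomp (set_valP y))) =
    (fun y : E => ccomp (set_valP (k y))).
  by apply: funext => y; exact: comp_congr.
exact: H.
Qed.

Definition subcategory : compactCategory :=
  @CompactCategory sob sarr sdom scod sid scomp sdom_id scod_id sdom_comp
    scod_comp scomp1c scompc1 scompA sob_compact sob_hausdorff sarr_compact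
    sarr_hausdorff sdom_continuous scod_continuous sid_continuous
    scomp_continuous.

End Subcategory.

Section KaroubiMirage.
Variables (V : pseudovariety) (hLSl : forall S, LSl S -> V S).
Variables (A : finType) (X : subshift A).
Local Notation F := (profree V A).
Local Notation K := (karoubi (F : compactSemigroupType)).

Definition mirage_ob : set (ob K) := [set e | mirage V X (val e)].

Definition mirage_arr : set (arr K) := [set x | mirage V X (val x).1.2].

Lemma mirage_dom (x : arr K) : mirage_arr x -> mirage_ob (dom x).
Proof.
move=> Mx; apply: (@mirage_mulWr V A X (val x).1.2).
by move: Mx; rewrite /mirage_arr /= -[in X in X -> _]karrr.
Qed.

Lemma mirage_cod (x : arr K) : mirage_arr x -> mirage_ob (cod x).
Proof.
move=> Mx; apply: (@mirage_mulWl V A X _ (val x).1.2).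
by move: Mx; rewrite /mirage_arr /= -[in X in X -> _]karrl.
Qed.

Lemma mirage_id (e : ob K) : mirage_ob e -> mirage_arr (idc e).
Proof. by []. Qed.

Lemma mirage_comp (x y : arr K) (p : dom x = cod y) :
  mirage_arr x -> mirage_arr y -> mirage_arr (ccomp p).
Proof.
move=> Mx My; apply: (mirage_mul hLSl (f := (val x).2)) => //.
- by case: (set_valP x).
- exact: karrr.
- by rewrite -[(val x).2]/(val (dom x)) p; exact: karrl.
Qed.

Lemma mirage_ob_closed : closed mirage_ob.
Proof.
have h := @val_continuous _ (@kob (F : compactSemigroupType)).
have H := closed_preimage h (@mirage_closed V hLSl A X); exact: H.
Qed.

Lemma mirage_arr_closed : closed mirage_arr.
Proof.
have h := continuous_comp_fun (continuous_comp_fun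
  (@val_continuous _ (@karr (F : compactSemigroupType)))
  (@fst_continuous _ _)) (@snd_continuous _ _).
have H := closed_preimage h (@mirage_closed V hLSl A X); exact: H.
Qed.

Definition mirage_subcategory : closedSubcategory K :=
  ClosedSubcategory mirage_dom mirage_cod mirage_id mirage_comp
    mirage_ob_closed mirage_arr_closed.

Definition karoubi_mirage : compactCategory := subcategory mirage_subcategory.

End KaroubiMirage.

Arguments karoubi_mirage {V} hLSl {A} X.

(* Main.v *)
From mathcomp Require Import all_boot.
From HB Require Import structures.
From mathcomp Require Import all_algebra generic_quotient.
From mathcomp Require Import all_classical topology.
From mathcomp Require Import zify.
Require Import Defs.

(** Since [V = V * D] is monoidal, every map on words computed by a transducer
    that remembers the last [k] letters and outputs a possibly empty word at each
    step is uniformly continuous for the pro-[V] structures, so it extends to the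
    free pro-[V] semigroups.  Identities between such extensions are checked on
    words, along the net of words approximating the given elements; elements of
    the mirage are approximated by words whose short factors lie in the language.

    A conjugacy is given by a sliding block code [F] with a symmetric window of
    radius [m].  It sends an arrow [(e, u, f)] to the code of [u] extended by the
    last [m] letters of [e] and the first [m] letters of [f]; as [u = e u f] this
    is functorial, and the functor of the inverse code is a strict inverse.

    For a symbol expansion, the two functors are induced by the expansion [E] and
    by the erasure [D] of the new letter, with [D E = 1].  An idempotent [f] of the
    mirage of the expansion either satisfies [E D f = f] or starts with the new
    letter, [f = <> z], and then [E D f = z <>]; removing the leading [<>] gives the
    natural isomorphism from [1] to [E D]. *)

Set Implicit Arguments.
Unset Strict Implicit.
Unset Printing Implicit Defensive.

Local Open Scope classical_set_scope.
Local Open Scope group_scope.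
Local Open Scope quotient_scope.

(** * Continuous equivalence *)

Section TotalComposition.
Variable C : compactCategory.
Implicit Types f g h : arr C.

(* The value on non-composable pairs is junk. *)
Definition tcomp f g : arr C :=
  if pselect (dom f = cod g) is left p then ccomp p else f.

Lemma tcompE f g (p : dom f = cod g) : ccomp p = tcomp f g.
Proof. by rewrite /tcomp; case: pselect => // q; exact: comp_congr. Qed.

Lemma dom_tcomp f g : dom f = cod g -> dom (tcomp f g) = dom g.
Proof. by move=> p; rewrite -tcompE dom_comp. Qed.

Lemma cod_tcomp f g : dom f = cod g -> cod (tcomp f g) = cod f.
Proof. by move=> p; rewrite -tcompE cod_comp. Qed.

Lemma tcomp1c f c : c = cod f -> tcomp (idc c) f = f.
Proof. by move=> ->; rewrite -(tcompE (dom_id (cod f))) comp1c. Qed.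

Lemma tcompc1 f c : c = dom f -> tcomp f (idc c) = f.
Proof. by move=> ->; rewrite -(tcompE (esym (cod_id (dom f)))) compc1. Qed.

Lemma tcompA f g h : dom f = cod g -> dom g = cod h ->
  tcomp (tcomp f g) h = tcomp f (tcomp g h).
Proof.
move=> p q; move: (compA p q); rewrite tcompE (tcompE (etrans p _)).
by rewrite !tcompE.
Qed.

Lemma tcomp_continuous (T : topologicalType) (f g : T -> arr C) :
  continuous f -> continuous g -> (forall t, dom (f t) = cod (g t)) ->
  continuous (fun t => tcomp (f t) (g t)).
Proof.
move=> cf cg p.
pose E := [set fg : arr C * arr C | dom fg.1 = cod fg.2].
have Ek t : E (f t, g t) := p t.
pose k t : E := exist (fun x => x \in E) _ (mem_set (Ek t)).
have ck : continuous k.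
  by apply: continuous_to_set_type; exact: (continuous_pairing cf cg).
have H := continuous_comp_fun ck (@comp_continuous C).
have -> : (fun t => tcomp (f t) (g t)) = (fun t => ccomp (set_valP (k t))).
  by apply: funext => t; rewrite tcompE.
exact: H.
Qed.

Lemma is_isoP f : is_iso f <-> exists g, [/\ dom f = cod g, dom g = cod f,
  tcomp f g = idc (cod f) & tcomp g f = idc (dom f)].
Proof.
split=> [[g [p [q]]]|[g [p q]]]; first by rewrite !tcompE => -[]; exists g.
by rewrite -(tcompE p) -(tcompE q) => *; exists g, p, q.
Qed.

Lemma is_iso_id (c : ob C) : is_iso (idc c).
Proof.
apply/is_isoP; exists (idc c).
by rewrite tcomp1c ?dom_id ?cod_id.
Qed.

Lemma is_iso_comp f g : dom f = cod g -> is_iso f -> is_iso g ->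
  is_iso (tcomp f g).
Proof.
move=> fg /is_isoP[f' [a1 a2 a3 a4]] /is_isoP[g' [b1 b2 b3 b4]].
have gf : dom g' = cod f' by rewrite b2 -fg.
apply/is_isoP; exists (tcomp g' f').
rewrite !dom_tcomp// !cod_tcomp//; split=> //.
- rewrite tcompA ?cod_tcomp// -(tcompA b1 gf) b3 tcomp1c//.
  by rewrite -fg.
- rewrite tcompA ?cod_tcomp// -(tcompA a2 fg) a4 tcomp1c//.
Qed.

End TotalComposition.

Section Equivalence.

Lemma farr_tcomp (C D : compactCategory) (F : continuousFunctor C D) f g :
  dom f = cod g -> farr F (tcomp f g) = tcomp (farr F f) (farr F g).
Proof.
by move=> p; rewrite -(tcompE p); have [q ->] := farr_comp F p; rewrite tcompE.
Qed.

Lemma is_iso_farr (C D : compactCategory) (F : continuousFunctor C D) f :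
  is_iso f -> is_iso (farr F f).
Proof.
move=> /is_isoP[g [p q fg gf]]; apply/is_isoP; exists (farr F g).
by rewrite !farr_dom !farr_cod -!farr_tcomp// fg gf !farr_id p q.
Qed.

(** Composability proofs disappear from the naturality squares, which can then be rewritten. *)
Lemma cisoP (C D : compactCategory) (F G : continuousFunctor C D) :
  continuously_isomorphic F G <-> exists eta : ob C -> arr D,
    [/\ continuous eta,
        forall c, dom (eta c) = fob F c /\ cod (eta c) = fob G c,
        forall c, is_iso (eta c) &
        forall f, tcomp (eta (cod f)) (farr F f) =
                  tcomp (farr G f) (eta (dom f))].
Proof.
split=> -[eta [ce de ie ne]]; exists eta; split=> // f.
  by have [p [q]] := ne f; rewrite !tcompE.
have p : dom (eta (cod f)) = cod (farr F f) by rewrite (de _).1 farr_cod.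
have q : dom (farr G f) = cod (eta (dom f)) by rewrite (de _).2 farr_dom.
by exists p, q; rewrite !tcompE.
Qed.

(** The components are identities. In [cequiv_trans] this stands for the associativity and unit laws
    of functor composition, without equalities of records. *)
Lemma ciso_eq (C D : compactCategory) (F G : continuousFunctor C D) :
  fob F =1 fob G -> farr F =1 farr G -> continuously_isomorphic F G.
Proof.
move=> obE arrE; apply/cisoP; exists (fun c => idc (fob G c)); split=> [|c|c|f].
- exact: (continuous_comp_fun (@fob_continuous _ _ G) (@id_continuous D)).
- by rewrite dom_id cod_id obE.
- exact: is_iso_id.
- by rewrite arrE tcomp1c ?tcompc1 ?farr_dom ?farr_cod.
Qed.

Lemma ciso_trans (C D : compactCategory) (F G H : continuousFunctor C D) :
  continuously_isomorphic F G -> continuously_isomorphic G H ->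
  continuously_isomorphic F H.
Proof.
move=> /cisoP[eta [ce de ie ne]] /cisoP[mu [cm dm im nm]].
have d c : dom (mu c) = cod (eta c) by rewrite (de c).2 (dm c).1.
apply/cisoP; exists (fun c => tcomp (mu c) (eta c)); split=> [|c|c|f].
- exact: tcomp_continuous.
- by rewrite dom_tcomp// cod_tcomp// (de c).1 (dm c).2.
- exact: is_iso_comp.
rewrite tcompA//; last by rewrite (de _).1 farr_cod.
rewrite ne -tcompA; [|by rewrite (dm _).1 farr_cod|by rewrite farr_dom (de _).2].
by rewrite nm tcompA// farr_dom (dm _).2.
Qed.

Lemma ciso_whisker_l (C D E : compactCategory) (F G : continuousFunctor C D)
    (H : continuousFunctor D E) : continuously_isomorphic F G ->
  continuously_isomorphic (comp_functor H F) (comp_functor H G).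
Proof.
move=> /cisoP[eta [ce de ie ne]]; apply/cisoP.
exists (fun c => farr H (eta c)); split=> [|c|c|f] /=.
- exact: (continuous_comp_fun ce (@farr_continuous _ _ H)).
- by rewrite farr_dom farr_cod (de c).1 (de c).2.
- exact: is_iso_farr.
rewrite -!farr_tcomp ?ne//; first by rewrite farr_dom (de _).2.
by rewrite farr_cod (de _).1.
Qed.

Lemma ciso_whisker_r (C D E : compactCategory) (F G : continuousFunctor D E)
    (H : continuousFunctor C D) : continuously_isomorphic F G ->
  continuously_isomorphic (comp_functor F H) (comp_functor G H).
Proof.
move=> /cisoP[eta [ce de ie ne]]; apply/cisoP.
exists (fun c => eta (fob H c)); split=> [|c|c|f] //=.
- exact: (continuous_comp_fun (@fob_continuous _ _ H) ce).
- by rewrite -(farr_cod H) -(farr_dom H).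
Qed.

Lemma cequiv_refl (C : compactCategory) : continuously_equivalent C C.
Proof. by exists (id_functor C), (id_functor C); split; exact: ciso_eq. Qed.

Lemma cequiv_sym (C D : compactCategory) :
  continuously_equivalent C D -> continuously_equivalent D C.
Proof. by move=> [F [G [FG GF]]]; exists G, F. Qed.

Lemma cequiv_trans (C D E : compactCategory) : continuously_equivalent C D ->
  continuously_equivalent D E -> continuously_equivalent C E.
Proof.
move=> [F [G [FG GF]]] [F' [G' [FG' GF']]].
exists (comp_functor F' F), (comp_functor G G'); split.
  apply: ciso_trans FG'.
  apply: (ciso_trans (G := comp_functor F' (comp_functor (comp_functor F G) G'))).
    exact: ciso_eq.
  apply: ciso_whisker_l.
  apply: (ciso_trans (ciso_whisker_r G' FG)); exact: ciso_eq.
apply: ciso_trans GF.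
apply: (ciso_trans (G := comp_functor G (comp_functor (comp_functor G' F') F))).
  exact: ciso_eq.
apply: ciso_whisker_l.
apply: (ciso_trans (ciso_whisker_r F GF')); exact: ciso_eq.
Qed.

End Equivalence.

(** * Transducers *)

Section LastLetters.
Variables (T : Type) (k : nat).
Implicit Types s t : seq T.

Definition lastn s := drop (size s - k) s.

Lemma size_lastn s : size (lastn s) = minn k (size s).
Proof. by rewrite size_drop; lia. Qed.

Lemma lastn_id s : size s <= k -> lastn s = s.
Proof. by rewrite /lastn => /eqP ->; rewrite drop0. Qed.

Lemma lastn_catr s t : k <= size t -> lastn (s ++ t) = lastn t.
Proof.
move=> kt; rewrite /lastn size_cat -addnBA// drop_cat.
by rewrite ltnNge leq_addr /= addnC addnK.
Qed.

Lemma cat_lastn s : take (size s - k) s ++ lastn s = s.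
Proof. exact: cat_take_drop. Qed.

(** Together with [lastn_lastnr], the reason why contexts form a semigroup: the last [k] letters of
    a product are determined by those of its factors. *)
Lemma lastn_catl s t : lastn (lastn s ++ t) = lastn (s ++ t).
Proof.
have [sk|ks] := leqP (size s) k; first by rewrite (lastn_id sk).
rewrite -[in RHS](cat_lastn s) -catA [RHS]lastn_catr//.
rewrite size_cat size_lastn; lia.
Qed.

Lemma lastn_lastnr s t : lastn (s ++ lastn t) = lastn (s ++ t).
Proof.
have [tk|kt] := leqP (size t) k; first by rewrite (lastn_id tk).
rewrite !lastn_catr ?size_lastn; [|lia..].
by rewrite lastn_id// size_lastn geq_minl.
Qed.

End LastLetters.

Lemma lastn_lastn (T : Type) a b (s : seq T) : a <= b ->
  lastn a (lastn b s) = lastn a s.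
Proof.
by move=> ab; rewrite /lastn size_drop drop_drop; congr drop; lia.
Qed.

(** * Closure of [V] under powers and under adjoining an identity *)

Section AdjoinIdentity.
Variable S : finSemigroupType.

Definition adjoin : Type := option S.
HB.instance Definition _ := Finite.copy adjoin (option S).

Definition adj_mul (x y : adjoin) : adjoin :=
  match x, y with
  | Some a, Some b => Some (a * b)
  | None, _ => y
  | _, None => x
  end.

Lemma adj_mulA : associative adj_mul.
Proof. by move=> [x|] [y|] [z|] //=; rewrite mulgA. Qed.

HB.instance Definition _ := isSemigroup.Build adjoin adj_mulA.

End AdjoinIdentity.

Section AdjoinMap.
Variables (S T : finSemigroupType) (f : {multiplicative S -> T}).

Definition adj_map (x : adjoin S) : adjoin T := omap f x.

Lemma adj_mapM x y : adj_map (x * y) = adj_map x * adj_map y.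
Proof. by case: x y => [x|] [y|] //; rewrite /adj_map /= gmulfM. Qed.

HB.instance Definition _ := isMultiplicative.Build _ _ adj_map adj_mapM.

End AdjoinMap.

Section AdjoinMonoid.
Variables (S : finSemigroupType) (e : S).
Hypothesis eP : forall x, e * x = x /\ x * e = x.

(* [eP] is a phantom argument: it keys the morphism structure. *)
Definition adj_split (_ : forall x, e * x = x /\ x * e = x) (x : adjoin S) :
    (S * adjoin trivial_semigroup)%type :=
  if x is Some s then (s, Some tt) else (e, None).

Lemma adj_splitM x y : adj_split eP (x * y) = adj_split eP x * adj_split eP y.
Proof.
case: x y => [x|] [y|] //; congr (_, _);
  by rewrite ?(eP _).1 ?(eP _).2.
Qed.

HB.instance Definition _ := isMultiplicative.Build _ _ (adj_split eP) adj_splitM.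

End AdjoinMonoid.

Section AdjoinProd.
Variables S T : finSemigroupType.

Definition adj_prod (x : adjoin (S * T)%type) : (adjoin S * adjoin T)%type :=
  if x is Some (s, t) then (Some s, Some t) else (None, None).

Lemma adj_prodM x y : adj_prod (x * y) = adj_prod x * adj_prod y.
Proof. by case: x y => [[s t]|] [[s' t']|]. Qed.

HB.instance Definition _ := isMultiplicative.Build _ _ adj_prod adj_prodM.

End AdjoinProd.

Definition to_trivial (S : finSemigroupType) (x : S) : trivial_semigroup := tt.
Lemma to_trivialM (S : finSemigroupType) (x y : S) :
  to_trivial (x * y) = to_trivial x * to_trivial y.
Proof. by []. Qed.
HB.instance Definition _ S := isMultiplicative.Build _ _ (@to_trivial S)
  (@to_trivialM S).

(** This is the two-element semilattice; for a monoid [S], [adj_split] embeds [adjoin S] in the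
    product of [S] with it. *)
Lemma LSl_adjoin_trivial : LSl (adjoin trivial_semigroup : finSemigroupType).
Proof. by move=> [[]|] _; split=> [[[]|] [[]|]|[[]|]]. Qed.

HB.instance Definition _ (I : finType) (S : finSemigroupType) :=
  Semigroup.on {ffun I -> S}.

Section FunctionSplit.
Variables (I : finType) (S : finSemigroupType) (i : I).

Definition ffun_split (f : {ffun I -> S}) : (S * {ffun {j | j != i} -> S})%type :=
  (f i, [ffun j => f (val j)]).

Lemma ffun_splitM f g : ffun_split (f * g) = ffun_split f * ffun_split g.
Proof.
rewrite /ffun_split !ffunE; congr (_, _).
by apply/ffunP => j; rewrite !ffunE.
Qed.

HB.instance Definition _ := isMultiplicative.Build _ _ ffun_split ffun_splitM.

End FunctionSplit.

Section PseudovarietyClosure.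
Variable V : pseudovariety.

(** The power is built by splitting off one coordinate at a time; the empty power is trivial. *)
Lemma pv_ffun (I : finType) (S : finSemigroupType) :
  V S -> V ({ffun I -> S} : finSemigroupType).
Proof.
move=> VS; move: {2}#|I| (erefl #|I|) => n; elim: n I => [|n IH] I In.
  by apply: (pv_triv (pvP V)); rewrite card_ffun In expn0.
have [i _] : exists i : I, i \in I by apply/card_gt0P; rewrite In.
apply: (pv_sub (pvP V) (f := @ffun_split I S i)).
  move=> f g [fgi fgD]; apply/ffunP => j.
  have [-> //|ji] := eqVneq j i.
  by have := congr1 (fun h : {ffun _ -> _} => h (exist _ j ji)) fgD; rewrite !ffunE.
apply: (pv_prod (pvP V)) => //; apply: IH.
rewrite card_sig; have := cardC1 i; rewrite In /= => <-.
by apply: eq_card => j; rewrite !inE.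
Qed.

Hypothesis V_monoidal : monoidal V.
Hypothesis V_LSl : forall S : finSemigroupType, LSl S -> V S.

(** Once the [S] with [S^1] in [V] form a pseudovariety, checking a generating class suffices in
    [pv_adjoin]. *)
Lemma is_pseudovariety_adjoin :
  is_pseudovariety (fun S => V (adjoin S : finSemigroupType)).
Proof.
split=> [S T f injf VT|S T f surjf VS|S S1|S T VS VT].
- apply: (pv_sub (pvP V) (f := adj_map f)) VT.
  by move=> [x|] [y|] //= [/injf ->].
- apply: (pv_img (pvP V) (f := adj_map f)) VS.
  move=> [y|]; last by exists None.
  by have [x <-] := surjf y; exists (Some x).
- apply: (pv_sub (pvP V) (f := adj_map (@to_trivial S)))
    (V_LSl LSl_adjoin_trivial).
  move=> [x|] [y|] //= _; congr Some.
  have /card_le1_eqP := eq_leq S1; exact.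
- apply: (pv_sub (pvP V) (f := @adj_prod S T)) (pv_prod (pvP V) VS VT).
  by move=> [[s t]|] [[s' t']|] //= [-> ->].
Qed.

(** By monoidality only monoids have to be treated, and for them [S^1] embeds in the product of [S]
    with the two-element semilattice. *)
Lemma pv_adjoin (S : finSemigroupType) : V S -> V (adjoin S : finSemigroupType).
Proof.
have [C [Cmon VC]] := V_monoidal.
move=> /VC /(_ (Pseudovariety is_pseudovariety_adjoin)); apply => T CT /=.
have [e eP] := Cmon T CT.
apply: (pv_sub (pvP V) (f := adj_split eP)).
  by move=> [x|] [y|] //= [->].
apply: (pv_prod (pvP V)); last exact/V_LSl/LSl_adjoin_trivial.
by apply/VC => U; apply.
Qed.

End PseudovarietyClosure.

(** * Transducers as morphisms into wreath products *)

Section Transducer.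
Variables (A B : Type) (k : nat) (out : seq A -> A -> seq B).

(* [x] is the context: the last [k] letters read so far. *)
Fixpoint transduce (x s : seq A) : seq B :=
  if s is a :: s' then out x a ++ transduce (lastn k (rcons x a)) s' else [::].

(** The cocycle rule behind the semidirect product: [t] is read from the context reached after
    [s]. *)
Lemma transduce_cat x s t : size x <= k ->
  transduce x (s ++ t) = transduce x s ++ transduce (lastn k (x ++ s)) t.
Proof.
elim: s x => [|a s IH] x xk /=; first by rewrite cats0 lastn_id.
rewrite IH ?size_lastn ?geq_minl// catA lastn_catl cat_rcons.
by [].
Qed.

End Transducer.

Section ContextAction.
Variables (A : finType) (k : nat).

Definition context (w : word A) : k.-bseq A := insub_bseq k (lastn k w).

Lemma val_context w : context w = lastn k w :> seq A.
Proof. by rewrite val_insubd size_lastn geq_minl. Qed.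

Lemma context_eq u v : context u = context v <-> lastn k u = lastn k v.
Proof. by rewrite -!val_context; split=> [->//|/val_inj]. Qed.

Lemma contextM u u' v v' : context u = context u' -> context v = context v' ->
  context (u * v) = context (u' * v').
Proof.
move=> /context_eq uu /context_eq vv; apply/context_eq => /=.
by rewrite -lastn_lastnr -lastn_catl uu vv lastn_catl lastn_lastnr.
Qed.

Definition contexts : finSemigroupType := fimg contextM.

Lemma val_contexts_mul (s t : contexts) :
  val (val (s * t)) = lastn k (val (val s) ++ val (val t)).
Proof.
rewrite -[s]fclsK -[t]fclsK -fcls_mul /= !val_context /=.
by rewrite lastn_catl lastn_lastnr.
Qed.

(** An idempotent is represented by words longer than [k], which hide whatever precedes them. *)
Lemma Dpv_contexts : Dpv contexts.
Proof.
move=> e s ee; pose w := wpow (frep e) k.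
have -> : e = fcls contextM w.
  suff: forall n, e = fcls contextM (wpow (frep e) n) by exact.
  elim=> [|n IH] /=; first by rewrite fclsK.
  by rewrite fclsM -IH fclsK -[LHS]ee.
rewrite -[s]fclsK -fcls_mul; apply/fcls_eq/context_eq => /=.
by rewrite lastn_catr// ltnW// size_wpow.
Qed.

(** States are all sequences of at most [k] letters, so that the empty one, the initial state, is
    always among them. *)
Definition ctx_step (x : k.-bseq A) (t : contexts) : k.-bseq A :=
  insub_bseq k (lastn k (val x ++ val (val t))).

Lemma val_ctx_step x t : val (ctx_step x t) = lastn k (val x ++ val (val t)).
Proof. by rewrite val_insubd size_lastn geq_minl. Qed.

Variable S : finSemigroupType.
Local Notation SX := ({ffun k.-bseq A -> S} : finSemigroupType).

(** Contexts act on states on the right, hence on functions of states on the left; the resulting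
    semidirect product is a wreath product. *)
Definition ctx_act (t : contexts) (f : SX) : SX := [ffun x => f (ctx_step x t)].

Lemma ctx_actM t f g : ctx_act t (f * g) = ctx_act t f * ctx_act t g.
Proof. by apply/ffunP => x; rewrite !ffunE. Qed.

Lemma ctx_actA s t f : ctx_act (s * t) f = ctx_act s (ctx_act t f).
Proof.
apply/ffunP => x; rewrite !ffunE; congr (f _); apply: val_inj.
rewrite !val_ctx_step val_contexts_mul lastn_lastnr.
by rewrite lastn_catl catA.
Qed.

Definition ctx_action := LeftAction ctx_actM ctx_actA.

End ContextAction.

Section TransducerMorphism.
Variables (A B : finType) (k : nat) (out : seq A -> A -> seq B).
Variables (S : finSemigroupType) (f : {multiplicative word B -> S}).

(** Empty output is sent to the adjoined identity [None]; this is why [adjoin S] replaces [S]. *)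
Definition adj_value (s : seq B) : adjoin S := omap f (insub s).

Lemma adj_value_cat s t : adj_value (s ++ t) = adj_value s * adj_value t.
Proof.
rewrite /adj_value.
case: insubP => [u _ us|]; last first.
  rewrite negbK => /eqP/nilP; rewrite cat_nilp => /andP[/nilP -> /nilP ->].
  by rewrite insubF.
case: insubP => [v _ vs|]; last first.
  rewrite negbK => /eqP s0; move: us; rewrite s0 /= => us.
  by rewrite -us valK.
case: insubP => [w _ wt|]; last first.
  rewrite negbK => /eqP t0; move: us; rewrite t0 cats0 -vs => /val_inj -> /=.
  by [].
have -> : u = v * w by apply: val_inj; rewrite /= us -vs -wt.
by rewrite /= gmulfM.
Qed.

Definition transducer_mor (w : word A) : semidirect (ctx_action A k (adjoin S)) :=
  ([ffun x : k.-bseq A => adj_value (transduce k out x w)],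
   fcls (@contextM A k) w).

Lemma transducer_morM u v :
  transducer_mor (u * v) = transducer_mor u * transducer_mor v.
Proof.
congr (_, _); last exact: fcls_mul.
apply/ffunP => x; rewrite !ffunE /= transduce_cat ?size_bseq// adj_value_cat.
congr (_ * adj_value (transduce _ _ _ _)).
by rewrite val_ctx_step /= val_context lastn_lastnr.
Qed.

HB.instance Definition _ :=
  isMultiplicative.Build _ _ transducer_mor transducer_morM.

End TransducerMorphism.

Section VContinuous.
Variable V : pseudovariety.

(* Uniform continuity for the pro-[V] uniform structures. *)
Definition vcont (A B : finType) (f : word A -> word B) :=
  forall r : vcongruence V B, exists s : vcongruence V A,
    forall u v, s u v -> r (f u) (f v).

Hypothesis V_monoidal : monoidal V.
Hypothesis V_LSl : forall S : finSemigroupType, LSl S -> V S.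
Hypothesis V_D : forall S : finSemigroupType, V S <-> semidirect_pv V Dpv S.

Section Transduction.
Variables (A B : finType) (k : nat) (out : seq A -> A -> seq B) (d : word B).

Definition transduction (w : word A) : word B :=
  insubd d (transduce k out [::] w).

(** The kernel of [transducer_mor] is fine enough: the target is a semidirect product of a power of
    [S^1] by a member of [D], hence lies in [V]. *)
Lemma vcont_transduction : vcont transduction.
Proof.
move=> r; have [S [g [VS /bij_inj ginj]]] := vcong_in r.
pose f (w : word B) : S := g (\pi_(wquot r) w).
have fM u v : f (u * v) = f u * f v by rewrite /f pi_qmul gmulfM.
pose fm : {multiplicative word B -> S} :=
  HB.pack f (isMultiplicative.Build _ _ f fM).
have [|s sP] := @mul_vcong V A _ (@transducer_mor A B k out S fm).
  apply/V_D => U hU; apply: hU.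
  exists ({ffun k.-bseq A -> adjoin S} : finSemigroupType), (contexts A k).
  exists (ctx_action A k (adjoin S)); split=> //; last exact: Dpv_contexts.
  exact/pv_ffun/pv_adjoin.
(* Evaluation at the empty context gives the actual output. If it is empty for one word it is empty
   for the other, and both images are the default [d]. *)
exists s => u v /sP[/ffunP/(_ (insub_bseq k [::])) + _].
rewrite !ffunE /= val_insubd /= /adj_value /transduction /insubd.
case: insubP => [u' _ _|_]; case: insubP => [v' _ _|_] //= [].
by move=> /ginj/pi_eqP.
Qed.

End Transduction.

(** Such a map is constant on the classes of the local congruence, whose quotient lies in [LSl]. *)
Lemma vcont_sig n (A B : finType) (f : word A -> word B) :
  (forall u v : word A, take n u = take n v -> take n (rev u) = take n (rev v) ->
    f u = f v) -> vcont f.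
Proof.
move=> fP r; have [s sP] := @local_vcong V V_LSl A n.
exists s => u v /sP/local_sigP[h1 h2 _]; by rewrite (fP u v).
Qed.

End VContinuous.

(** * Extensions and nets *)

Section Extension.
Variables (V : pseudovariety) (A B : finType).
Local Notation FA := (profree V A).
Local Notation FB := (profree V B).
Variable f : word A -> word B.
Implicit Types (r : vcongruence V B) (s : vcongruence V A) (x : FA).

Definition approx (s : vcongruence V A) (x : FA) : word A :=
  repr (pcoord s x : wquot s).

Lemma approxK s x : \pi_(wquot s) (approx s x) = pcoord s x.
Proof. exact: reprK. Qed.

Lemma approx_fine (s s' : vcongruence V A) x :
  (forall u v, s' u v -> s u v) -> \pi_(wquot s) (approx s' x) = pcoord s x.
Proof. by move=> s's; rewrite -(set_valP x s' s s's). Qed.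

Hypothesis fc : vcont V f.

Definition modulus (r : vcongruence V B) : vcongruence V A := projT1 (cid (fc r)).

Lemma modulusP r u v : modulus r u v -> r (f u) (f v).
Proof. exact: (projT2 (cid (fc r))). Qed.

Definition ext_fun (x : FA) : wquot_product V B :=
  fun r => \pi_(wquot r) (f (approx (modulus r) x)).

(** Independence of the chosen modulus, from which the compatibility of the coordinates follows. *)
Lemma ext_fine (r : vcongruence V B) (s : vcongruence V A) x :
  (forall u v, s u v -> modulus r u v) ->
  \pi_(wquot r) (f (approx s x)) = ext_fun x r.
Proof.
by move=> sr; apply/pi_eqP/modulusP/pi_eqP; rewrite approxK approx_fine.
Qed.

Lemma ext_subproof (x : FA) : ext_fun x \in @compatible V B.
Proof.
apply/mem_set => r r' rr'.
have [s [sr sr']] := vcongruence_meet (modulus r) (modulus r').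
rewrite -(ext_fine x sr) -(ext_fine x sr').
by apply/pi_eqP/rr'/pi_eqP; rewrite reprK.
Qed.

Definition ext (x : FA) : FB :=
  exist (fun z => z \in @compatible V B) (ext_fun x) (ext_subproof x).

(** The coordinate at [r] factors through the discrete coordinate at [modulus r]. *)
Lemma ext_continuous : continuous ext.
Proof.
apply: continuous_to_set_type; apply: continuous_to_prod => r.
pose s := modulus r.
have h2 : continuous ((fun y => \pi_(wquot r) (f (repr (y : wquot s)))) :
    discrete_topology (wquot s) -> discrete_topology (wquot r)).
  move=> y; apply/discrete_cvg.
  by apply: (@filterS _ (nbhs y) _ [set y]) => [z ->//|]; exact: discrete_set1.
have h := continuous_comp_fun (@pcoord_continuous V A s) h2; exact: h.
Qed.

End Extension.

Section WindowsOfPoints.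
Variable A : finType.
Implicit Types (X : subshift A) (x : fullshift A) (i : int) (s z : seq A).

Definition window x i n : seq A := mkseq (fun j => x (i + j%:Z)%R) n.

(* [language X] as a set of sequences, including the empty one. *)
Definition lang X s := exists2 x, subshift_set X x & exists i, s = window x i (size s).

Lemma lang_nil X : lang X [::].
Proof. by have [x Xx] := subshift_nonempty X; exists x => //; exists 0%R. Qed.

Lemma lang_window X x i n : subshift_set X x -> lang X (window x i n).
Proof. by move=> Xx; exists x => //; exists i; rewrite size_mkseq. Qed.

(** Words approximating an element of the mirage need not be in the language; only their short
    factors are controlled. *)
Definition admissible X n s := forall z, infix z s -> size z <= n -> lang X z.

Lemma admissible_infix X n s t : infix s t -> admissible X n t -> admissible X n s.
Proof. by move=> st at_ z zs; apply: at_; exact: infix_trans zs st. Qed.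

End WindowsOfPoints.

(** * Convergence of nets of words *)

Section Nets.
Variables (V : pseudovariety) (A : finType).
Local Notation I := (vcongruence V A).

(** Tails of the set of [V]-congruences on one alphabet, directed by refinement. The same index set
    serves for words over other alphabets, so that several limits can be compared. *)
Definition eventually (P : I -> Prop) :=
  exists s0 : I, forall s : I, (forall u v, s u v -> s0 u v) -> P s.

Lemma eventually_true (P : I -> Prop) : (forall s, P s) -> eventually P.
Proof. by move=> ?; have [s] := vcongruence_inhabited V A; exists s. Qed.

Lemma eventually_ex (P : I -> Prop) : eventually P -> exists s, P s.
Proof. by move=> [s sP]; exists s; exact: sP. Qed.

Lemma eventually_and (P Q : I -> Prop) :
  eventually P -> eventually Q -> eventually (fun s => P s /\ Q s).
Proof.
move=> [s sP] [t tQ]; have [r [rs rt]] := vcongruence_meet s t.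
by exists r => q qr; split; [apply: sP|apply: tQ] => u v /qr; auto.
Qed.

Lemma eventuallyS (P Q : I -> Prop) :
  (forall s, P s -> Q s) -> eventually P -> eventually Q.
Proof. by move=> PQ [s sP]; exists s => t /sP; exact: PQ. Qed.

Section Limit.
Variable B : finType.
Local Notation F := (profree V B).
Implicit Types (W : I -> word B) (x y : F).

Definition lim W x := forall r : vcongruence V B,
  eventually (fun s => pcoord r x = \pi_(wquot r) (W s)).

(** The way identities between pro-[V] elements are proved: they only have to hold eventually on
    approximating words. *)
Lemma lim_unique W W' x y : lim W x -> lim W' y ->
  eventually (fun s => W s = W' s) -> x = y.
Proof.
move=> Wx Wy E; apply: profree_ext => r.
have [s [[-> ->] ->//]] :=
  eventually_ex (eventually_and (eventually_and (Wx r) (Wy r)) E).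
Qed.

Lemma lim_mul W W' x y : lim W x -> lim W' y ->
  lim (fun s => W s * W' s) (x * y).
Proof.
move=> Wx Wy r; apply: eventuallyS (eventually_and (Wx r) (Wy r)) => s [xE yE].
by rewrite pi_qmul -xE -yE.
Qed.

(** Allows an idempotent to be approximated by words with more than [n] letters. *)
Lemma lim_wpow W e n : idem e -> lim W e -> lim (fun s => wpow (W s) n) e.
Proof.
move=> ee We; elim: n => [//|n IH] /=.
by rewrite -[e]ee; exact: lim_mul.
Qed.

End Limit.

Lemma lim_ext (B C : finType) (f : word B -> word C) (fc : vcont V f)
    (W : I -> word B) x :
  lim W x -> lim (fun s => f (W s)) (ext fc x).
Proof.
move=> Wx r; apply: eventuallyS (Wx (modulus fc r)) => s xE.
apply/pi_eqP/modulusP/pi_eqP; rewrite approxK; exact: xE.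
Qed.

Lemma lim_approx (x : profree V A) : lim (fun s => approx s x) x.
Proof. by move=> r; exists r => s sr; rewrite approx_fine. Qed.

Hypothesis V_LSl : forall S : finSemigroupType, LSl S -> V S.

(** Having a given short factor is decided by the coordinate at the local congruence, which [W s]
    eventually shares with [x]. *)
Lemma lim_factor (B : finType) (W : I -> word B) x (n : nat) : lim W x ->
  eventually (fun s => forall z : word B, size z <= n ->
    factor (incl V z) x <-> infix (wseq z) (wseq (W s))).
Proof.
move=> Wx; have [r rP] := @local_vcong V V_LSl B n.
apply: eventuallyS (Wx r) => s xE z zn; exact: (factor_inclP rP zn xE).
Qed.

Lemma lim_mirage (B : finType) (X : subshift B) (W : I -> word B) x n :
  lim W x -> mirage V X x -> eventually (fun s => admissible X n (W s)).
Proof.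
move=> /(lim_factor n) E Mx; apply: eventuallyS E => s sP [|a z] zW zn.
  exact: lang_nil.
by apply: (Mx (Word (isT : a :: z != [::]))); apply/sP.
Qed.

(** A factor [z] of [x] is eventually an infix of [W s], and admissibility at length [size z] puts
    it in the language. *)
Lemma mirage_lim (B : finType) (X : subshift B) (W : I -> word B) x :
  lim W x -> (forall n, eventually (fun s => admissible X n (W s))) ->
  mirage V X x.
Proof.
move=> Wx E z zx.
have [s [sF sa]] :=
  eventually_ex (eventually_and (lim_factor (size z) Wx) (E (size z))).
exact: sa ((sF z (leqnn _)).1 zx) (leqnn _).
Qed.

End Nets.

(** * Functors between Karoubi envelopes of mirages *)

Section KaroubiMirageAccess.
Variables (V : pseudovariety) (V_LSl : forall S, LSl S -> V S).
Variables (A : finType) (X : subshift A).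
Local Notation F := (profree V A).
Local Notation K := (karoubi_mirage V_LSl X).

Definition obval (c : ob K) : F := val (val c).

Definition arrval (a : arr K) : F * F * F := val (val a).

Lemma obval_idem c : idem (obval c).
Proof. exact: set_valP (val c). Qed.

Lemma obval_mirage c : mirage V X (obval c).
Proof. exact: set_valP c. Qed.

Lemma obval_inj : injective obval.
Proof. by move=> c d /val_inj/val_inj. Qed.

Lemma arrval_inj : injective arrval.
Proof. by move=> c d /val_inj/val_inj. Qed.

Lemma obval_continuous : continuous obval.
Proof.
have h1 := @val_continuous _ (sub_ob (mirage_subcategory V_LSl X)).
have h2 := @val_continuous _ (@kob (profree V A : compactSemigroupType)).
have h := continuous_comp_fun h1 h2; exact: h.
Qed.

Lemma arrval_continuous : continuous arrval.
Proof.
have h1 := @val_continuous _ (sub_arr (mirage_subcategory V_LSl X)).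
have h2 := @val_continuous _ (@karr (profree V A : compactSemigroupType)).
have h := continuous_comp_fun h1 h2; exact: h.
Qed.

Lemma continuous_to_ob (T : topologicalType) (f : T -> ob K) :
  continuous (fun t => obval (f t)) -> continuous f.
Proof.
by move=> h; apply: continuous_to_set_type; apply: continuous_to_set_type.
Qed.

Lemma continuous_to_arr (T : topologicalType) (f : T -> arr K) :
  continuous (fun t => arrval (f t)) -> continuous f.
Proof.
by move=> h; apply: continuous_to_set_type; apply: continuous_to_set_type.
Qed.

Lemma arrval_idc c : arrval (idc c) = (obval c, obval c, obval c).
Proof. by []. Qed.

Lemma obval_dom a : obval (dom a) = (arrval a).2.
Proof. by []. Qed.

Lemma obval_cod a : obval (cod a) = (arrval a).1.1.
Proof. by []. Qed.

Lemma arrval_comp a b (p : dom a = cod b) : arrval (ccomp p) =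
  ((arrval a).1.1, (arrval a).1.2 * (arrval b).1.2, (arrval b).2).
Proof. by []. Qed.

Definition is_arrow (x : F * F * F) : Prop :=
  [/\ idem x.1.1, idem x.2, x.1.2 = x.1.1 * x.1.2 * x.2 & mirage V X x.1.2].

Lemma arrvalP a : is_arrow (arrval a).
Proof. by have [h1 h2 h3] := set_valP (val a); split=> //; exact: set_valP a. Qed.

Lemma arrval_ids e : idem e -> mirage V X e -> is_arrow (e, e, e).
Proof. by move=> ee Me; split=> //=; rewrite !ee. Qed.

Definition mkob e (ee : idem e) (Me : mirage V X e) : ob K :=
  exist (fun c => c \in sub_ob (mirage_subcategory V_LSl X))
    (exist (fun c => c \in @kob (profree V A : compactSemigroupType)) e
      (mem_set ee)) (mem_set Me).

Definition mkarr x (xP : is_arrow x) : arr K :=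
  exist (fun c => c \in sub_arr (mirage_subcategory V_LSl X))
    (exist (fun c => c \in @karr (profree V A : compactSemigroupType)) x
      (mem_set (let: And4 h1 h2 h3 _ := xP in And3 h1 h2 h3)))
    (mem_set (let: And4 _ _ _ h := xP in h)).

Lemma arrval_tcomp a b : (arrval a).2 = (arrval b).1.1 -> arrval (tcomp a b) =
  ((arrval a).1.1, (arrval a).1.2 * (arrval b).1.2, (arrval b).2).
Proof.
move=> h; have p : dom a = cod b by exact: obval_inj.
by rewrite -(tcompE p).
Qed.

End KaroubiMirageAccess.

Arguments obval_mirage {V V_LSl A X} c.

Section MirageFunctor.
Variables (V : pseudovariety) (V_LSl : forall S, LSl S -> V S).

(** The middle component of a functor. It depends on the whole triple because a block code reads
    letters of both end idempotents. The image of the object [e] is [Psi (e, e, e)], idempotent by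
    [mm_mul]. *)
Record mirage_map (A B : finType) (X : subshift A) (Y : subshift B)
    (Psi : profree V A * profree V A * profree V A -> profree V B) : Prop := {
  mm_continuous : continuous Psi;
  mm_mul : forall e u f v g, is_arrow X (e, u, f) -> is_arrow X (f, v, g) ->
    Psi (e, u * v, g) = Psi (e, u, f) * Psi (f, v, g);
  mm_mirage : forall x, is_arrow X x -> mirage V Y (Psi x) }.

Definition arrow_map (A B : finType)
    (Psi : profree V A * profree V A * profree V A -> profree V B)
    (x : profree V A * profree V A * profree V A) :=
  (Psi (x.1.1, x.1.1, x.1.1), Psi x, Psi (x.2, x.2, x.2)).

Section Functor.
Variables (A B : finType) (X : subshift A) (Y : subshift B).
Variable Psi : profree V A * profree V A * profree V A -> profree V B.
Hypothesis PsiP : mirage_map X Y Psi.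
Implicit Types (x : profree V A * profree V A * profree V A) (e : profree V A).

Lemma is_arrow_cod x : is_arrow X x -> is_arrow X (x.1.1, x.1.1, x.1.1).
Proof.
move=> [h1 h2 h3 h4]; apply: arrval_ids => //.
by apply: (@mirage_mulWl _ _ _ _ (x.1.2 * x.2)); rewrite mulgA -h3.
Qed.

Lemma is_arrow_dom x : is_arrow X x -> is_arrow X (x.2, x.2, x.2).
Proof.
move=> [h1 h2 h3 h4]; apply: arrval_ids => //.
by apply: (@mirage_mulWr _ _ _ (x.1.1 * x.1.2)); rewrite -h3.
Qed.

Lemma mm_idem e : is_arrow X (e, e, e) -> idem (Psi (e, e, e)).
Proof.
by move=> he; have [ee _ _ _] := he; rewrite /idem -(mm_mul PsiP)// [e * e]ee.
Qed.

(** The factorization of the middle component is [mm_mul] applied to [u = e u] and [u = u f]. *)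
Lemma is_arrow_map x : is_arrow X x -> is_arrow Y (arrow_map Psi x).
Proof.
move=> hx; have hc := is_arrow_cod hx; have hd := is_arrow_dom hx.
split=> /=; [exact: mm_idem|exact: mm_idem| |exact: mm_mirage hx].
move: hx hc hd; case: x => [[e u] f] /= hx hc hd.
have [/= ee ff uE _] := hx.
have eu : e * u = u by rewrite uE !mulgA ee.
have uf : u * f = u by rewrite uE -!mulgA ff.
by rewrite -(mm_mul PsiP)// eu -(mm_mul PsiP)// uf.
Qed.

Local Notation KX := (karoubi_mirage V_LSl X).
Local Notation KY := (karoubi_mirage V_LSl Y).

Lemma is_arrow_ob (c : ob KX) : is_arrow X (obval c, obval c, obval c).
Proof. by apply: arrval_ids; [exact: obval_idem|exact: obval_mirage]. Qed.

Definition mob (c : ob KX) : ob KY :=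
  mkob V_LSl (mm_idem (is_arrow_ob c)) (mm_mirage PsiP (is_arrow_ob c)).

Definition marr (a : arr KX) : arr KY := mkarr V_LSl (is_arrow_map (arrvalP a)).

Lemma arrval_marr a : arrval (marr a) = arrow_map Psi (arrval a).
Proof. by []. Qed.

Definition mirage_functor : continuousFunctor KX KY.
Proof.
apply: (@ContinuousFunctor KX KY mob marr).
- by move=> a; apply: obval_inj.
- by move=> a; apply: obval_inj.
- by move=> c; apply: arrval_inj.
- move=> a b p.
  have q : dom (marr a) = cod (marr b).
    apply: obval_inj => /=.
    rewrite obval_dom obval_cod !arrval_marr /arrow_map /=.
    by rewrite -obval_dom p obval_cod.
  exists q; apply: arrval_inj; rewrite arrval_marr !arrval_comp !arrval_marr.
  rewrite /arrow_map /=; congr (_, _, _).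
  have ha := arrvalP a; have hb := arrvalP b; move: ha hb (congr1 (@obval _ _ _ _) p).
  rewrite obval_dom obval_cod.
  case: (arrval a) (arrval b) => [[e u] f] [[f' v] g] /= ha hb E.
  by subst f'; exact: (mm_mul PsiP).
- apply: continuous_to_ob.
  have h := @obval_continuous V V_LSl A X.
  have H := continuous_comp_fun (continuous_pairing (continuous_pairing h h) h)
    (mm_continuous PsiP); exact: H.
- apply: continuous_to_arr.
  have h := @arrval_continuous V V_LSl A X.
  have h1 := continuous_comp_fun (continuous_comp_fun h (@fst_continuous _ _))
    (@fst_continuous _ _).
  have h2 := continuous_comp_fun h (@snd_continuous _ _).
  have H1 := continuous_comp_fun (continuous_pairing (continuous_pairing h1 h1) h1)
    (mm_continuous PsiP).
  have H2 := continuous_comp_fun (continuous_pairing (continuous_pairing h2 h2) h2)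
    (mm_continuous PsiP).
  have H := continuous_pairing (continuous_pairing H1
    (continuous_comp_fun h (mm_continuous PsiP))) H2; exact: H.
Defined.

End Functor.

(** The hypothesis at the identity arrows [(e, e, e)] also settles the objects, so the composite is
    strictly the identity. *)
Lemma mirage_functor_inverse (A B : finType) (X : subshift A) (Y : subshift B)
    Psi Phi (PsiP : mirage_map X Y Psi) (PhiP : mirage_map Y X Phi) :
  (forall x, is_arrow X x -> Phi (arrow_map Psi x) = x.1.2) ->
  continuously_isomorphic
    (comp_functor (mirage_functor PhiP) (mirage_functor PsiP)) (id_functor _).
Proof.
move=> PhiPsi; apply: ciso_eq => [c|a] /=.
  by apply: obval_inj; exact: (PhiPsi _ (is_arrow_ob c)).
apply: arrval_inj; rewrite !arrval_marr; have ha := arrvalP a.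
rewrite [LHS]/arrow_map PhiPsi// [in LHS]/arrow_map /=.
rewrite (PhiPsi _ (is_arrow_cod ha)) (PhiPsi _ (is_arrow_dom ha)) /=.
by rewrite -!surjective_pairing.
Qed.

(** Here [p] is the action of [F] on elements, [t' e] the component [p e -> e] of the isomorphism
    and [t e] its inverse. Both lie in the mirage as factors of [e = t' e * t e]. *)
Lemma ciso_mirage_id (A : finType) (X : subshift A)
    (F : continuousFunctor (karoubi_mirage V_LSl X) (karoubi_mirage V_LSl X))
    (p t t' : profree V A -> profree V A) :
  (forall c, obval (fob F c) = p (obval c)) ->
  (forall a, (arrval (farr F a)).1.2 = p (arrval a).1.2) ->
  continuous p -> continuous t' ->
  (forall e, idem e -> mirage V X e -> [/\ t e * t' e = p e, t' e * t e = e,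
     t' e = e * t' e * p e & t e = p e * t e * e]) ->
  (forall e u f, is_arrow X (e, u, f) -> t' e * p u = u * t' f) ->
  continuously_isomorphic F (id_functor _).
Proof.
move=> FO FA cp ct' tP nat.
pose K := karoubi_mirage V_LSl X.
have cP (c : ob K) := tP _ (obval_idem c) (obval_mirage c).
have arr1 (c : ob K) : is_arrow X (obval c, t' (obval c), p (obval c)).
  have [h1 h2 h3 h4] := cP c; split=> //=; first exact: obval_idem.
    by rewrite -FO; exact: obval_idem.
  by apply: (@mirage_mulWl _ _ _ _ (t (obval c))); rewrite h2; exact: obval_mirage.
have arr2 (c : ob K) : is_arrow X (p (obval c), t (obval c), obval c).
  have [h1 h2 h3 h4] := cP c; split=> //=.
  - by rewrite -FO; exact: obval_idem.
  - exact: obval_idem.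
  - by apply: (@mirage_mulWr _ _ _ (t' (obval c))); rewrite h2; exact: obval_mirage.
pose eta (c : ob K) : arr K := mkarr V_LSl (arr1 c).
have etaE c : arrval (eta c) = (obval c, t' (obval c), p (obval c)) by [].
apply/cisoP; exists eta; split=> [|c|c|a].
- apply: continuous_to_arr.
  have h := @obval_continuous V V_LSl A X.
  have H := continuous_pairing (continuous_pairing h
    (continuous_comp_fun h ct')) (continuous_comp_fun h cp); exact: H.
- by split; apply: obval_inj; rewrite ?obval_dom ?obval_cod etaE//= FO.
- have [h1 h2 h3 h4] := cP c.
  apply/is_isoP; exists (mkarr V_LSl (arr2 c)).
  have d1 : dom (eta c) = cod (mkarr V_LSl (arr2 c)) by exact: obval_inj.
  have d2 : dom (mkarr V_LSl (arr2 c)) = cod (eta c) by exact: obval_inj.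
  split=> //; apply: arrval_inj; rewrite arrval_tcomp//= arrval_idc.
    by rewrite obval_cod etaE /= h2.
  by rewrite obval_dom etaE /= h1.
- have E1 : (arrval (farr F a)).1.1 = p (arrval a).1.1.
    by rewrite -obval_cod farr_cod FO obval_cod.
  have E2 : (arrval (farr F a)).2 = p (arrval a).2.
    by rewrite -obval_dom farr_dom FO obval_dom.
  apply: arrval_inj; rewrite !arrval_tcomp etaE ?E1 ?E2//=.
  rewrite FA obval_cod obval_dom; congr (_, _, _); apply: nat.
  by have := arrvalP a; rewrite {1}(surjective_pairing (arrval a))
    {1}(surjective_pairing (arrval a).1).
Qed.

End MirageFunctor.

(** * Conjugacy *)

Section SlidingBlock.
Variables (A B : Type) (n : nat) (F : seq A -> B).
Implicit Types s t w : seq A.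

(** Windows have [n + 1] letters, so [n] letters are lost; truncated subtraction makes the code of a
    short sequence empty. *)
Definition slide s : seq B :=
  mkseq (fun i => F (take n.+1 (drop i s))) (size s - n).

Lemma size_slide s : size (slide s) = size s - n.
Proof. exact: size_mkseq. Qed.

Lemma slide_nil s : size s <= n -> slide s = [::].
Proof. by move=> sn; apply/nilP; rewrite /nilp size_slide subn_eq0. Qed.

Lemma slide_cons a s : n <= size s ->
  slide (a :: s) = F (take n.+1 (a :: s)) :: slide s.
Proof.
move=> ns; rewrite /slide /= subSn// /mkseq /= (iotaDl 1 0) -map_comp.
by congr cons; apply: eq_map => i /=.
Qed.

(** Windows starting in [s] end inside [s ++ w]; all others lie in [w ++ t]. *)
Lemma slide_overlap s w t : size w = n ->
  slide (s ++ w ++ t) = slide (s ++ w) ++ slide (w ++ t).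
Proof.
move=> wn; elim: s => [|a s IH]; first by rewrite (slide_nil (s := w)) ?wn.
rewrite !cat_cons !slide_cons ?size_cat ?wn; [|lia..].
rewrite IH /= catA takel_cat// size_cat wn; lia.
Qed.

Lemma take_drop_slide a i s :
  take a (drop i (slide s)) = slide (take (a + n) (drop i s)).
Proof.
rewrite /slide -map_drop -map_take drop_iota take_iota size_take_min size_drop.
have -> : minn (a + n) (size s - i) - n = minn a (size s - n - i) by lia.
rewrite /mkseq add0n -[X in iota X _]addn0 iotaDl -map_comp.
apply/eq_in_map => j; rewrite mem_iota => /andP[_ jb] /=.
rewrite (addnC i) -drop_drop !take_drop take_takel//; lia.
Qed.

(** Output starts once the context has [n] letters, when context and new letter form a complete
    window. *)
Definition slide_out (x : seq A) a : seq B :=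
  if size x == n then [:: F (rcons x a)] else [::].

Lemma transduce_slide x s : size x <= n ->
  transduce n slide_out x s = slide (x ++ s).
Proof.
elim: s x => [|a s IH] x xn /=; first by rewrite cats0 slide_nil.
rewrite IH ?size_lastn ?geq_minl// /slide_out.
have [xE|xE] := eqVneq (size x) n; last first.
  by rewrite lastn_id ?cat_rcons// size_rcons; lia.
(* An empty context is full only for [n = 0], and then it stays empty. *)
case: x xE {xn IH} => [|b x] /= xE.
  have -> : lastn n [:: a] = [::] by rewrite /lastn -xE.
  by rewrite slide_cons -xE //= take0.
rewrite slide_cons ?size_cat /=; last by lia.
rewrite /lastn /= size_rcons -xE subSnn /= drop0 cat_rcons; congr cons.
congr F; rewrite -cat_rcons takel_cat ?size_rcons//.
by rewrite -rcons_cons take_oversize ?size_rcons.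
Qed.

End SlidingBlock.

Section SymmetricWindow.
Variables (A B : Type) (m : nat) (F : seq A -> B).
Implicit Types s t : seq A.
Local Notation slide := (slide (m + m) F).

(** [slide_overlap] with the [2 m] letters around the cut: each half is extended by the [m] adjacent
    letters of the other. This makes the functor of a code multiplicative. *)
Lemma slide_split s t : m <= size s -> m <= size t ->
  slide (s ++ t) = slide (s ++ take m t) ++ slide (lastn m s ++ t).
Proof.
move=> ms mt; rewrite -[in LHS](cat_lastn m s) -[in LHS](cat_take_drop m t).
rewrite -catA [lastn m s ++ _]catA slide_overlap; last first.
  by rewrite size_cat size_lastn size_takel//; lia.
by rewrite !catA cat_lastn -catA cat_take_drop.
Qed.

Lemma take_slide a s : take a (slide s) = slide (take (a + (m + m)) s).
Proof. by have := take_drop_slide (m + m) F a 0 s; rewrite !drop0. Qed.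

Lemma lastn_slide a s : a + (m + m) <= size s ->
  lastn a (slide s) = slide (lastn (a + (m + m)) s).
Proof.
move=> h; rewrite /lastn -[LHS](take_oversize (n := a)); last first.
  by rewrite size_drop size_slide; lia.
rewrite take_drop_slide take_oversize ?size_drop ?size_slide; last by lia.
congr (slide (drop _ s)); lia.
Qed.

End SymmetricWindow.

(** * Subshifts and the Curtis-Hedlund-Lyndon theorem *)

Section Subshifts.
Variable A : finType.
Implicit Types (X : subshift A) (x : fullshift A).

Lemma cylinder_nbhs x k :
  nbhs x [set z : fullshift A | forall i : int, (absz i <= k)%N -> z i = x i].
Proof.
have c (j : int) : nbhs x [set z : fullshift A | z j = x j].
  have h : nbhs (x j : discrete_topology A) [set x j] by exact: discrete_set1.
  exact: (@proj_continuousT _ (fun _ : int => discrete_topology A) j x _ h).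
elim: k => [|k IH].
  by apply: filterS (c 0%R) => z z0 i; rewrite leqn0 absz_eq0 => /eqP ->.
apply: filterS (filterI IH (filterI (c k.+1) (c (- k.+1%:Z)%R))).
move=> z [zk [z1 z2]] i; rewrite leq_eqVlt => /orP[/eqP ik|]; last exact: zk.
have [->//|->//] : i = k.+1 \/ i = (- k.+1%:Z)%R by lia.
Qed.

(** Convergence in the product is tested one coordinate [j] at a time, and the cylinder of radius
    [|j|] fixes that coordinate. *)
Lemma nbhs_cylinder x (U : set (fullshift A)) : nbhs x U -> exists k,
  forall z : fullshift A, (forall i : int, (absz i <= k)%N -> z i = x i) -> U z.
Proof.
pose C k := [set z : fullshift A | forall i : int, (absz i <= k)%N -> z i = x i].
pose G : set_system (fullshift A) := filter_from [set: nat] C.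
have FG : Filter G.
  apply: filter_from_filter; first by exists 0%N.
  move=> k l _ _; exists (maxn k l) => // z zC.
  by split=> i ik; apply: zC; rewrite leq_max ik ?orbT.
suff Gx : G --> x by move=> /Gx [k _ kU]; exists k => z; exact: kU.
apply/cvg_sup => j W [_ [[O oO <-] /= Ox OW]].
apply: (@filterS _ G _ _ _ OW).
by exists (absz j) => //= z zC; rewrite /= zC.
Qed.

Lemma fullshift_compact : compact [set: fullshift A].
Proof.
have := @tychonoff int (fun _ : int => discrete_topology A)
  (fun=> setT) (fun _ =>
  @finite_compact (discrete_topology A) _ (@finite_finset A setT)).
by congr compact; apply/seteqP; split.
Qed.

(** Compactness gives a cluster point of the filter of tails; cylinder neighbourhoods turn
    clustering into agreement at arbitrarily late indices. *)
Lemma subshift_cluster X (y : nat -> fullshift A) :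
  (forall n, subshift_set X (y n)) -> exists2 x, subshift_set X x &
  forall k N, exists2 n, N <= n & forall i : int, (absz i <= k)%N -> y n i = x i.
Proof.
move=> Xy.
have cX : compact (subshift_set X).
  by apply: (subclosed_compact _ fullshift_compact) => //; exact: subshift_closed.
have FX : (y @ \oo) (subshift_set X) by exists 0%N => // n _; exact: Xy.
have [x [Xx cl]] := cX (y @ \oo) _ FX.
exists x => // k N.
have FN : (y @ \oo) (y @` [set n | N <= n]) by exists N => // n /= Nn; exists n.
have [_ [[n Nn <-] yn]] := cl _ _ FN (cylinder_nbhs x k).
by exists n.
Qed.

Lemma subshift_ext X x y : x =1 y -> subshift_set X x -> subshift_set X y.
Proof. by move=> /funext ->. Qed.

Lemma subshift_translate X x (j : int) : subshift_set X x ->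
  subshift_set X (fun i => x (i + j)%R).
Proof.
have fwd z : subshift_set X z -> subshift_set X (shiftmap z).
  by move=> Xz; rewrite -(subshift_shift X); exists z.
have bwd z : subshift_set X z -> subshift_set X (fun i => z (i - 1)%R).
  rewrite -{1}(subshift_shift X) => -[z' Xz' <-].
  by apply: subshift_ext Xz' => i; rewrite /shiftmap GRing.subrK.
move=> Xx; case: j => n; elim: n => [|n IH].
- by apply: subshift_ext Xx => i; rewrite GRing.addr0.
- by apply: subshift_ext (fwd _ IH) => i; rewrite /shiftmap; congr x; lia.
- by apply: subshift_ext (bwd _ Xx) => i; congr x; lia.
- by apply: subshift_ext (bwd _ IH) => i; congr x; lia.
Qed.

Lemma eq_window x y i j n :
  (forall k, k < n -> x (i + k%:Z)%R = y (j + k%:Z)%R) ->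
  window x i n = window y j n.
Proof. by move=> xy; apply/eq_in_map => k; rewrite mem_iota => /andP[_ /xy]. Qed.

Lemma drop_window x i n a :
  drop a (window x i n) = window x (i + a%:Z)%R (n - a).
Proof.
rewrite /window /mkseq -map_drop drop_iota add0n.
rewrite -[X in iota X _]addn0 iotaDl -map_comp.
by apply: eq_map => k /=; congr x; lia.
Qed.

Lemma take_window x i n a : take a (window x i n) = window x i (minn a n).
Proof. by rewrite /window /mkseq -map_take take_iota. Qed.

End Subshifts.

Section SlidingBlockCode.
Variables (A B : finType) (X : subshift A) (f : fullshift A -> fullshift B).
Hypothesis f_continuous : {within X, continuous f}.
Hypothesis f_shift : forall x, subshift_set X x -> f (shiftmap x) = shiftmap (f x).

(** Otherwise there are pairs agreeing on longer and longer central windows with different images at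
    [0]; both members come close to a common cluster point, against continuity there. *)
Lemma block_code_local : exists m, forall x y : fullshift A,
  subshift_set X x -> subshift_set X y ->
  (forall i : int, (absz i <= m)%N -> x i = y i) -> f x 0%R = f y 0%R.
Proof.
apply: contrapT => /forallNP nloc.
have /choice[p pP] : forall m, exists p : fullshift A * fullshift A,
    [/\ subshift_set X p.1, subshift_set X p.2,
      forall i : int, (absz i <= m)%N -> p.1 i = p.2 i & f p.1 0%R <> f p.2 0%R].
  move=> m; apply: contrapT => np; apply: (nloc m) => x y Xx Xy xy.
  by apply: contrapT => fxy; apply: np; exists (x, y).
have [x Xx xP] := @subshift_cluster A X (fun m => (p m).1)
  (fun m => let: And4 h _ _ _ := pP m in h).
have /subspace_continuousP/(_ x Xx) fx := f_continuous.
have /nbhs_cylinder[k kP] := fx _ (cylinder_nbhs (f x) 0).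
(* [k] serves both as radius and as lower bound on [m], so that the second point of the pair is also
   close to [x]. *)
have [m km mP] := xP k k.
have [X1 X2 p12 []] := pP m.
have mP2 (i : int) : (absz i <= k)%N -> (p m).2 i = x i.
  by move=> ik; rewrite -p12 ?mP// (leq_trans ik).
have E1 : f (p m).1 0%R = f x 0%R by exact: (kP _ mP X1 0%R).
have E2 : f (p m).2 0%R = f x 0%R by exact: (kP _ mP2 X2 0%R).
by rewrite E1 E2.
Qed.

Lemma block_code_translate x (j : int) : subshift_set X x ->
  f (fun i => x (i + j)%R) = (fun i => f x (i + j)%R).
Proof.
have pos (n : nat) (z : fullshift A) : subshift_set X z ->
    f (fun i => z (i + n%:Z)%R) = (fun i => f z (i + n%:Z)%R).
  move=> Xz; elim: n => [|n IH].
    transitivity (f z); last by apply: funext => i; rewrite GRing.addr0.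
    by congr f; apply: funext => i; rewrite GRing.addr0.
  transitivity (f (shiftmap (fun i => z (i + n%:Z)%R))).
    by congr f; apply: funext => i; rewrite /shiftmap; congr z; lia.
  rewrite f_shift ?IH; last exact: subshift_translate.
  by apply: funext => i; rewrite /shiftmap; congr (f z); lia.
move=> Xx; have [[n ->]|] : (exists n : nat, j = n) \/ exists n : nat, j = (- n%:Z)%R.
- by case: j => n; [left; exists n|right; exists n.+1; lia].
- exact: pos.
move=> [n ->].
have /(pos n) E := subshift_translate (- n%:Z)%R Xx.
apply: funext => i; have := congr1 (fun h => h (i - n%:Z)%R) E => /=.
rewrite GRing.subrK => <-; congr (f _ _); apply: funext => k; congr x; lia.
Qed.

(** The Curtis-Hedlund-Lyndon theorem. Every radius beyond some bound is allowed, so that a code and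
    its inverse can share one. *)
Lemma block_code : exists m0, forall m, m0 <= m -> exists F : seq A -> B,
  forall x, subshift_set X x -> forall i : int,
    f x i = F (window x (i - m%:Z)%R (m + m).+1).
Proof.
have [m0 m0P] := block_code_local; exists m0 => m m0m.
have [x0 _] := subshift_nonempty X.
pose P z x := subshift_set X x /\ window x (- m%:Z)%R (m + m).+1 = z.
(* Windows not occurring in [X] get the arbitrary value [f x0 0]. *)
pose F z := if pselect (exists x, P z x) is left h then f (projT1 (cid h)) 0%R
            else f x0 0%R.
exists F => x Xx i.
pose y : fullshift A := fun j => x (j + i)%R.
have Xy : subshift_set X y by exact: subshift_translate.
have -> : f x i = f y 0%R by rewrite /y block_code_translate// GRing.add0r.
have wE : window x (i - m%:Z)%R (m + m).+1 = window y (- m%:Z)%R (m + m).+1.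
  by apply: eq_window => k _; rewrite /y; congr x; lia.
rewrite /F; case: pselect => [h|[]]; last by exists y; split.
case: (cid h) => z /= [Xz zE]; apply: m0P => // j jm.
have jk : (j = - m%:Z + (absz (j + m%:Z)%R)%:Z)%R by lia.
have kb : absz (j + m%:Z)%R < (m + m).+1 by lia.
move: zE; rewrite wE => /(congr1 (fun s => nth (y 0%R) s (absz (j + m%:Z)%R))).
by rewrite !nth_mkseq// -jk.
Qed.

End SlidingBlockCode.

(** * Block codes on admissible words *)

Section CodesOnWindows.
Variables (A B : finType) (m : nat).

Definition codes (X : subshift A) (F : seq A -> B)
    (f : fullshift A -> fullshift B) :=
  forall x, subshift_set X x -> forall i : int,
    f x i = F (window x (i - m%:Z)%R (m + m).+1).

Variables (X : subshift A) (Y : subshift B) (F : seq A -> B).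
Variable f : fullshift A -> fullshift B.
Hypothesis FP : codes X F f.
Hypothesis fY : forall x, subshift_set X x -> subshift_set Y (f x).

Lemma slide_window x i k : subshift_set X x ->
  slide (m + m) F (window x i k) = window (f x) (i + m%:Z)%R (k - (m + m)).
Proof.
move=> Xx; rewrite /slide size_mkseq; apply/eq_in_map => j.
rewrite mem_iota => /andP[_ jk]; rewrite FP//; congr F.
rewrite drop_window take_window; have -> : minn (m + m).+1 (k - j) = (m + m).+1 by lia.
by apply: eq_window => l _; congr x; lia.
Qed.

Lemma infix_slide z s : infix z (slide (m + m) F s) -> exists z',
  [/\ infix z' s, size z' <= size z + (m + m) & z = slide (m + m) F z'].
Proof.
move=> /infixP[p [t E]].
have zE : z = take (size z) (drop (size p) (slide (m + m) F s)).
  by rewrite E drop_size_cat// take_size_cat.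
exists (take (size z + (m + m)) (drop (size p) s)); split.
- apply/infixP; exists (take (size p) s), (drop (size z + (m + m)) (drop (size p) s)).
  by rewrite !cat_take_drop.
- by rewrite size_take_min geq_minl.
- by rewrite {1}zE take_drop_slide.
Qed.

(** A factor of the code comes from a factor of [s] with at most [2 m] more letters, which occurs in
    a point of [X]. *)
Lemma admissible_slide n s : admissible X (n + (m + m)) s ->
  admissible Y n (slide (m + m) F s).
Proof.
move=> sX z /infix_slide[z' [z's zz' zE]] zn; rewrite zE.
have [|x Xx [i ->]] := sX z' z's; first by rewrite (leq_trans zz')// leq_add2r.
by rewrite slide_window//; apply: lang_window; exact: fY.
Qed.

End CodesOnWindows.

(** Each letter of the double code depends on [4 m + 1] letters of [s], which occur in a point [x]
    of [X]; there [g (f x) = x] gives back the central one. So [2 m] letters are lost at each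
    end. *)
Lemma slide_slide (A B : finType) m (X : subshift A) (Y : subshift B)
    (F : seq A -> B) (G : seq B -> A) f g s :
  codes m X F f -> codes m Y G g ->
  (forall x, subshift_set X x -> subshift_set Y (f x) /\ g (f x) = x) ->
  admissible X (m + m + (m + m)).+1 s ->
  slide (m + m) G (slide (m + m) F s) =
    take (size s - (m + m + (m + m))) (drop (m + m) s).
Proof.
move=> FP GP fg sX.
have [a0|] := posnP (size s - (m + m + (m + m))).
  rewrite a0 take0 slide_nil// size_slide; lia.
case: s sX => [|a0 s'] //; move: (a0 :: s') => s sX s0.
apply: (@eq_from_nth _ a0).
  rewrite !size_slide size_take_min size_drop; lia.
move=> i; rewrite !size_slide => ib.
pose z := take (m + m + (m + m)).+1 (drop i s).
have zs : infix z s.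
  apply/infixP; exists (take i s), (drop (m + m + (m + m)).+1 (drop i s)).
  by rewrite !cat_take_drop.
have szz : size z = (m + m + (m + m)).+1 by rewrite size_take_min size_drop; lia.
have [|x Xx [j zE]] := sX z zs; first by rewrite szz.
rewrite {1}/slide nth_mkseq ?size_slide; last by lia.
rewrite take_drop_slide addSn -/z zE szz (slide_window FP j _ Xx).
have [Yfx gfx] := fg x Xx.
have := GP _ Yfx (j + (m + m)%:Z)%R; rewrite gfx => E.
have -> : window (f x) (j + m%:Z)%R ((m + m + (m + m)).+1 - (m + m)) =
    window (f x) (j + (m + m)%:Z - m%:Z)%R (m + m).+1.
  by rewrite subSn ?leq_addr// addnK; apply: eq_window => l _; congr (f x); lia.
rewrite -E.
(* The centre of the window [z] is its letter of index [2 m]. *)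
have := congr1 (fun t => nth a0 t (m + m)) zE.
rewrite szz nth_mkseq; last by lia.
rewrite nth_take; last by lia.
rewrite nth_drop nth_take; last by lia.
by rewrite nth_drop addnC => ->.
Qed.

Section ArrowCode.
Variables (A B : Type) (m : nat) (F : seq A -> B).
Implicit Types h u k : seq A.
Local Notation slide := (slide (m + m) F).

(* Both sides are the code of the middle factor with [2 m] extra letters of
   context, as needed to apply a second code with the same window. *)
Lemma slide_arrow h u k : 0 < m -> m + m <= size h -> m + m <= size k ->
  lastn m (slide (lastn m h ++ h ++ take m h)) ++
    slide (lastn m h ++ (h ++ u ++ k) ++ take m k) ++
    take m (slide (lastn m k ++ k ++ take m k)) =
  slide (lastn (m + m) h ++ (h ++ u ++ k) ++ take (m + m) k).
Proof.
move=> m0 mh mk.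
have slh a : a <= size h -> size (lastn a h) = a by rewrite size_lastn; lia.
have slk a : a <= size k -> size (lastn a k) = a by rewrite size_lastn; lia.
have stk a : a <= size k -> size (take a k) = a by rewrite size_take_min; lia.
have sth a : a <= size h -> size (take a h) = a by rewrite size_take_min; lia.
(* The last [m] letters of the code come from the last [3 m] letters of its source, and
   symmetrically for the first [m] letters of the code at [k]. *)
rewrite lastn_slide; last by rewrite !size_cat slh ?sth; lia.
have -> : lastn (m + (m + m)) (lastn m h ++ h ++ take m h) =
    lastn (m + m) h ++ take m h.
  rewrite lastn_catr; last by rewrite size_cat sth; lia.
  rewrite {1}/lastn size_cat drop_cat sth; last by lia.
  rewrite ifT; last by lia.
  by congr (drop _ _ ++ _); lia.
rewrite take_slide.
have -> : take (m + (m + m)) (lastn m k ++ k ++ take m k) =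
    lastn m k ++ take (m + m) k.
  rewrite take_cat slk; last by lia.
  rewrite ifF; last by lia.
  by rewrite addKn takel_cat.
(* The same two end pieces are cut off the right-hand side, one at each junction. *)
rewrite [RHS]slide_split; last 2 first.
- by rewrite slh//; lia.
- by rewrite !size_cat; lia.
rewrite lastn_lastn; last by lia.
congr (_ ++ _).
  by rewrite -catA takel_cat//; lia.
rewrite catA [RHS](_ : _ = slide ((lastn m h ++ h ++ u ++ k) ++ take (m + m) k));
  last by rewrite -!catA.
rewrite [RHS]slide_split; last 2 first.
- by rewrite !size_cat; lia.
- by rewrite stk; lia.
rewrite take_takel; last by lia.
rewrite !catA lastn_catr ?slk//; lia.
Qed.

End ArrowCode.

(** * The functor of a sliding block code *)

Section EndLetters.
Variables (A : finType) (m : nat).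
Hypothesis m_gt0 : 0 < m.

(** The default [w] is never taken, since [m] is positive; likewise for [wlastn]. *)
Definition wtake (w : word A) : word A := insubd w (take m w).

Definition wlastn (w : word A) : word A := insubd w (lastn m w).

Lemma word_gt0 (w : word A) : 0 < size w.
Proof. by case: w => [[]]. Qed.

Lemma val_wtake w : wtake w = take m w :> seq A.
Proof.
rewrite val_insubd ifT//.
by case: w => -[//|a s] _ /=; rewrite -(prednK m_gt0).
Qed.

Lemma val_wlastn w : wlastn w = lastn m w :> seq A.
Proof.
by rewrite val_insubd ifT// -size_eq0 size_lastn -lt0n leq_min m_gt0 word_gt0.
Qed.

Lemma rev_lastn (s : seq A) : rev (lastn m s) = take m (rev s).
Proof. by rewrite take_rev. Qed.

Variable V : pseudovariety.
Hypothesis V_LSl : forall S : finSemigroupType, LSl S -> V S.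

Lemma vcont_wtake : vcont V wtake.
Proof.
apply: (vcont_sig V_LSl (n := m)) => u v uv _.
by apply: val_inj => /=; rewrite !val_wtake.
Qed.

Lemma vcont_wlastn : vcont V wlastn.
Proof.
apply: (vcont_sig V_LSl (n := m)) => u v _ uv.
by apply/val_inj/(can_inj revK); rewrite /= !val_wlastn !rev_lastn.
Qed.

End EndLetters.

Lemma size_wpow_ge (A : finType) (w : word A) n : n <= size (wpow w n).
Proof. exact/ltnW/size_wpow. Qed.

Section ArrowLimits.
Variables (V : pseudovariety) (V_LSl : forall S : finSemigroupType, LSl S -> V S).
Variables (A : finType) (X : subshift A).

(* Arrows [u = e u f] are approximated by words [h w k] with [h] and [k]
   arbitrarily long approximations of [e] and [f]. *)
Lemma lim_arrow (e u f : profree V A) n : is_arrow X (e, u, f) ->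
  [/\ lim (fun s => wpow (approx s e) n) e, lim (fun s => wpow (approx s f) n) f &
    lim (fun s => wpow (approx s e) n * (approx s u * wpow (approx s f) n)) u].
Proof.
move=> [/= ee ff uE Mu].
have le := lim_wpow n ee (lim_approx e); have lf := lim_wpow n ff (lim_approx f).
split=> //; rewrite [X in lim _ X]uE -mulgA; apply: lim_mul => //.
by apply: lim_mul => //; exact: lim_approx.
Qed.

(** The outer copies of [h] and [k], harmless in the limit because [e u f = u], provide the letters
    that a code reads beyond the middle word. *)
Lemma lim_arrow_admissible (e u f : profree V A) n N : is_arrow X (e, u, f) ->
  eventually (fun s => let h := wpow (approx s e) n in
    let k := wpow (approx s f) n in
    admissible X N (h ++ (h ++ approx s u ++ k) ++ k)).
Proof.
move=> hx; have [lh lk lu] := lim_arrow n hx; have [_ _ /= uE Mu] := hx.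
apply: (lim_mirage V_LSl N (W := fun s => wpow (approx s e) n *
  ((wpow (approx s e) n * (approx s u * wpow (approx s f) n)) *
    wpow (approx s f) n))) Mu.
by rewrite [X in lim _ X]uE -mulgA; apply: lim_mul => //; exact: lim_mul.
Qed.

End ArrowLimits.

Section ConjugacyMap.
Variables (V : pseudovariety) (V_monoidal : monoidal V).
Hypothesis V_LSl : forall S : finSemigroupType, LSl S -> V S.
Hypothesis V_D : forall S : finSemigroupType, V S <-> semidirect_pv V Dpv S.
Variable m : nat.
Hypothesis m_gt0 : 0 < m.

Section Map.
Variables (A B : finType) (d : word B) (F : seq A -> B).

Definition wslide : word A -> word B :=
  transduction (m + m) (slide_out (m + m) F) d.

Lemma val_wslide (w : word A) : m + m < size w ->
  wslide w = slide (m + m) F w :> seq B.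
Proof.
move=> mw; rewrite val_insubd transduce_slide// cat0s ifT//.
by rewrite -size_eq0 size_slide -lt0n subn_gt0.
Qed.

Lemma vcont_wslide : vcont V wslide.
Proof. exact: vcont_transduction. Qed.

Definition conj_map (x : profree V A * profree V A * profree V A) : profree V B :=
  ext vcont_wslide (ext (vcont_wlastn m_gt0 V_LSl) x.1.1 * x.1.2 *
    ext (vcont_wtake m_gt0 V_LSl) x.2).

Definition wconj (h u k : word A) : word B :=
  wslide (wlastn m h * (u * wtake m k)).

Lemma val_wconj (h u k : word A) : m <= size h -> m <= size k ->
  wconj h u k = slide (m + m) F (lastn m h ++ u ++ take m k) :> seq B.
Proof.
move=> mh mk; have u0 := word_gt0 u.
rewrite val_wslide /= val_wlastn// val_wtake// !size_cat size_lastn size_take_min.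
by rewrite (minn_idPl mh) (minn_idPl mk) addnCA -[X in X < _]add0n ltn_add2r.
Qed.

Lemma lim_conj_map (C : finType) e u f (h w k : vcongruence V C -> word A) :
  lim h e -> lim w u -> lim k f ->
  lim (fun s => wconj (h s) (w s) (k s)) (conj_map (e, u, f)).
Proof.
move=> he wu kf; apply: lim_ext; rewrite /= -mulgA.
by apply: lim_mul; [exact: lim_ext|apply: lim_mul => //; exact: lim_ext].
Qed.

Lemma conj_map_continuous : continuous conj_map.
Proof.
pose T := (profree V A * profree V A * profree V A)%type.
have c11 : continuous (fun x : T => x.1.1).
  exact: continuous_comp_fun (@fst_continuous _ _) (@fst_continuous _ _).
have c12 : continuous (fun x : T => x.1.2).
  exact: continuous_comp_fun (@fst_continuous _ _) (@snd_continuous _ _).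
have c2 : continuous (fun x : T => x.2) by exact: snd_continuous.
have h1 := continuous_comp_fun c11 (ext_continuous (fc := vcont_wlastn m_gt0 V_LSl)).
have h2 := continuous_comp_fun c2 (ext_continuous (fc := vcont_wtake m_gt0 V_LSl)).
have h := mul_pair_continuous (mul_pair_continuous h1 c12) h2.
have H := continuous_comp_fun h (ext_continuous (fc := vcont_wslide)); exact: H.
Qed.

Variables (X : subshift A) (Y : subshift B) (f : fullshift A -> fullshift B).
Hypothesis FP : codes m X F f.
Hypothesis fY : forall x, subshift_set X x -> subshift_set Y (f x).

(** The words for [u] and [v] meet between two copies of a word approximating the middle idempotent
    [k]; [slide_split] at that junction separates the two codes. *)
Lemma conj_map_mul e u k v g : is_arrow X (e, u, k) -> is_arrow X (k, v, g) ->
  conj_map (e, u * v, g) = conj_map (e, u, k) * conj_map (k, v, g).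
Proof.
move=> hu hv; have [le lk lu] := lim_arrow m hu; have [_ lg lv] := lim_arrow m hv.
apply: (lim_unique (lim_conj_map le (lim_mul lu lv) lg)
  (lim_mul (lim_conj_map le lu lk) (lim_conj_map lk lv lg))).
apply: eventually_true => s; apply: val_inj => /=.
move: (wpow _ m) (size_wpow_ge (approx s e) m) => h0 mh0.
move: (wpow _ m) (size_wpow_ge (approx s k) m) => h1 mh1.
move: (wpow _ m) (size_wpow_ge (approx s g) m) => h2 mh2.
rewrite !val_wconj//= -[LHS]/(slide _ _ _) -!catA.
rewrite (catA h0) (catA (h0 ++ _)) (catA (lastn m h0)).
rewrite [LHS]slide_split ?size_cat; [|lia..].
by rewrite takel_cat// !catA lastn_catr.
Qed.

Lemma conj_map_mirage x : is_arrow X x -> mirage V Y (conj_map x).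
Proof.
case: x => [[e u] k] hx; have [le lk lu] := lim_arrow m hx.
apply: (mirage_lim V_LSl (lim_conj_map le lu lk)) => n.
apply: eventuallyS (lim_arrow_admissible V_LSl m (n + (m + m)) hx) => s /= sX.
rewrite val_wconj ?size_wpow_ge//=; apply: (admissible_slide FP fY).
apply: admissible_infix sX.
apply/infixP; exists (take (size (wpow (approx s e) m) - m) (wpow (approx s e) m)).
exists (drop m (wpow (approx s k) m)).
by rewrite -!catA cat_take_drop !catA cat_lastn.
Qed.

Lemma conj_map_mirage_map : mirage_map X Y conj_map.
Proof.
split; [exact: conj_map_continuous| |exact: conj_map_mirage].
by move=> e u k v g; exact: conj_map_mul.
Qed.

End Map.

(** By [slide_arrow] the double code is that of [h u k] extended by [2 m] letters on each side, and
    [slide_slide] strips exactly those letters. *)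
Lemma conj_mapK (A B : finType) (dA : word A) (dB : word B) F G
    (X : subshift A) (Y : subshift B) f g :
  codes m X F f -> codes m Y G g ->
  (forall x, subshift_set X x -> subshift_set Y (f x) /\ g (f x) = x) ->
  forall x, is_arrow X x ->
    conj_map dA G (arrow_map (conj_map dB F) x) = x.1.2.
Proof.
move=> FP GP fg [[e u] k] hx.
(* Exponent [m + m] makes [h] and [k] at least [2 m] letters long, as [slide_arrow] requires. *)
have [le lk lu] := lim_arrow (m + m) hx.
apply: (lim_unique (lim_conj_map dA G (lim_conj_map dB F le le le)
  (lim_conj_map dB F le lu lk) (lim_conj_map dB F lk lk lk)) lu).
have E := lim_arrow_admissible V_LSl (m + m) (m + m + (m + m)).+1 hx.
apply: eventuallyS E => s /=.
move: (wpow _ _) (size_wpow_ge (approx s e) (m + m)) => h mh.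
move: (wpow _ _) (size_wpow_ge (approx s k) (m + m)) => k' mk.
move=> sX; apply: val_inj => /=.
have h1 : m <= size h by exact: leq_trans (leq_addl _ _) mh.
have k1 : m <= size k' by exact: leq_trans (leq_addl _ _) mk.
rewrite val_wconj ?val_wconj//; last 2 first.
- by rewrite size_slide !size_cat size_lastn size_take_min; lia.
- by rewrite size_slide !size_cat size_lastn size_take_min; lia.
rewrite /= slide_arrow// (slide_slide FP GP fg).
  rewrite !size_cat size_lastn size_take_min (minn_idPl mh) (minn_idPl mk).
  rewrite drop_size_cat ?size_lastn ?(minn_idPl mh)//.
  rewrite take_cat !size_cat; case: ifP => [|_]; first lia.
  by rewrite (_ : _ - _ = 0) ?take0 ?cats0//; lia.
apply: admissible_infix sX.
apply/infixP; exists (take (size h - (m + m)) h), (drop (m + m) k').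
by rewrite -!catA cat_take_drop !catA cat_lastn.
Qed.

End ConjugacyMap.

Lemma conjugate_equiv (V : pseudovariety) (V_monoidal : monoidal V)
    (V_LSl : forall S : finSemigroupType, LSl S -> V S)
    (V_D : forall S : finSemigroupType, V S <-> semidirect_pv V Dpv S)
    (A B : finType) (X : subshift A) (Y : subshift B) :
  conjugate X Y ->
  continuously_equivalent (karoubi_mirage V_LSl X) (karoubi_mirage V_LSl Y).
Proof.
move=> [f [g [fc gc fg gf fs]]].
have gs y : subshift_set Y y -> g (shiftmap y) = shiftmap (g y).
  move=> /gf[Xgy fgy]; rewrite -{1}fgy -fs// (fg _ _).2//.
  by rewrite -(subshift_shift X); exists (g y).
have [mf mfP] := block_code fc fs; have [mg mgP] := block_code gc gs.
(* A common radius for both codes; the successor makes it positive, so that [wtake] and [wlastn]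
   produce nonempty words. *)
pose m := (mf + mg).+1.
have [|F FP] := mfP m; first by rewrite /m; lia.
have [|G GP] := mgP m; first by rewrite /m; lia.
have [x0 Xx0] := subshift_nonempty X.
(* Default words for the codes of sequences that are too short. *)
pose dA : word A := Word (isT : [:: x0 0%R] != [::]).
pose dB : word B := Word (isT : [:: f x0 0%R] != [::]).
have m_gt0 : 0 < m by [].
have PsiP := conj_map_mirage_map V_monoidal V_LSl V_D m_gt0 dB FP
  (fun x Xx => (fg x Xx).1).
have PhiP := conj_map_mirage_map V_monoidal V_LSl V_D m_gt0 dA GP
  (fun y Yy => (gf y Yy).1).
exists (mirage_functor V_LSl PsiP), (mirage_functor V_LSl PhiP).
split; apply: mirage_functor_inverse.
  exact: (conj_mapK _ _ _ _ _ _ GP FP gf).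
exact: (conj_mapK _ _ _ _ _ _ FP GP fg).
Qed.

(** * Symbol expansion *)

Section ExpansionWords.
Variables (A : finType) (alpha : A).
Local Notation B := (option A).
Implicit Types (s t : seq B) (a b c : B) (u : seq A) (x : A).

Definition expands u : seq B := flatten [seq expand_letter alpha x | x <- u].

Definition erase s : seq A := pmap id s.

Lemma expands_cons x u : expands (x :: u) = expand_letter alpha x ++ expands u.
Proof. by []. Qed.

Lemma expands_cat u v : expands (u ++ v) = expands u ++ expands v.
Proof. by rewrite /expands map_cat flatten_cat. Qed.

Lemma erase_cat s t : erase (s ++ t) = erase s ++ erase t.
Proof. exact: pmap_cat. Qed.

Lemma expandsK : cancel expands erase.
Proof.
elim=> [//|x u IH]; rewrite expands_cons erase_cat IH.
by rewrite /expand_letter; case: ifP.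
Qed.

Lemma size_letter x : 0 < size (expand_letter alpha x).
Proof. by rewrite /expand_letter; case: ifP. Qed.

Lemma size_expands u : size u <= size (expands u).
Proof.
elim: u => //= x u IH; rewrite expands_cons size_cat -add1n leq_add//.
exact: size_letter.
Qed.

(** Every letter expands to at least one letter, whence the bound on [size u']. *)
Lemma prefix_expands s u : prefix s (expands u) -> exists u',
  [/\ prefix u' u, size u' <= size s & prefix s (expands u')].
Proof.
elim: u s => [|x u IH] [|a s] pre //; try by exists [::].
move: pre; rewrite expands_cons => pre.
have [sx|xs] := leqP (size (a :: s)) (size (expand_letter alpha x)).
  exists [:: x]; split=> //; first by rewrite /= eqxx prefix0s.
  move: pre; rewrite !prefixE expands_cons !takel_cat//.
pose t := drop (size (expand_letter alpha x)) (a :: s).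
have st : a :: s = expand_letter alpha x ++ t.
  rewrite -[LHS](cat_take_drop (size (expand_letter alpha x))); congr (_ ++ _).
  have /prefixP[q E] := pre.
  apply: esym; have := congr1 (take (size (expand_letter alpha x))) E.
  by rewrite [in RHS]takel_cat ?(ltnW xs)// take_size_cat.
move: pre; rewrite st prefix_catr// eqxx => /IH[u' [u'u ss pre]].
exists (x :: u'); rewrite expands_cons prefix_catr// eqxx size_cat; split=> //.
  by rewrite /= eqxx.
by rewrite /= -add1n leq_add// size_letter.
Qed.

(** The successor accounts for a first letter of which only the end of the expansion may be met. *)
Lemma infix_expands s u : infix s (expands u) -> exists u',
  [/\ infix u' u, size u' <= (size s).+1 & infix s (expands u')].
Proof.
elim: u => [|x u IH]; first by rewrite infixs0 => /eqP ->; exists [::].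
rewrite expands_cons => /infix_cat[sx|/IH|].
- exists [:: x]; split=> //; last by rewrite expands_cons infix_catr.
  by rewrite -cat1s prefix_infix.
- move=> [u' [u'u us su]]; exists u'; split=> //.
  by rewrite -cat1s infix_catl.
move=> [s1 [s2 [-> /suffixP[p s1x]]]] /prefix_expands[u' [/prefixP[q ->] us]].
move=> /prefixP[r su]; exists (x :: u'); split.
- by rewrite -cat_cons prefix_infix.
- by rewrite size_cat /= ltnS (leq_trans us)// leq_addl.
- by apply/infixP; exists p, r; rewrite expands_cons s1x su -!catA.
Qed.

Lemma erase_split s u v : erase s = u ++ v ->
  exists s1 s2, [/\ s = s1 ++ s2, erase s1 = u & erase s2 = v].
Proof.
elim: s u => [|a s IH] u /=; first by case: u => //= <-; exists [::], [::].
case: a => [x|] /=; last first.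
  by move=> /IH[s1 [s2 [-> <- <-]]]; exists (None :: s1), s2.
case: u => [/= <-|y u [<- /IH[s1 [s2 [-> <- <-]]]]]; first by exists [::], (Some x :: s).
by exists (Some x :: s1), s2.
Qed.

Lemma infix_erase u s : infix u (erase s) -> exists2 t, infix t s & erase t = u.
Proof.
move=> /infixP[p [q /erase_split[s1 [s2 [-> _]]]]].
move=> /erase_split[s3 [s4 [-> <- _]]]; exists s3 => //.
by apply/infixP; exists s1, s4.
Qed.

Lemma infix_erase_mono s t : infix s t -> infix (erase s) (erase t).
Proof.
by move=> /infixP[p [q ->]]; rewrite !erase_cat infix_infix.
Qed.

Definition expansion_rel : rel B := fun a b => (b == None) == (a == Some alpha).

(** The local shape of factors of expansions: inside the sequence [None] stands exactly after
    [Some alpha], while a leading [None] and a trailing [Some alpha] are allowed. *)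
Definition expansion_like s := sorted expansion_rel s.

Lemma expands_like u : expansion_like (expands u).
Proof.
suff H a : (a != Some alpha) -> path expansion_rel a (expands u).
  by have /path_sorted := H None isT.
elim: u a => [//|x u IH] a aN; rewrite expands_cons /expand_letter.
have [->|xN] /= := eqVneq x alpha.
  by rewrite {1 2}/expansion_rel (negPf aN) eqxx IH.
by rewrite {1}/expansion_rel (negPf aN) /= IH.
Qed.

Lemma expansion_like_infix s t : infix s t -> expansion_like t -> expansion_like s.
Proof.
move=> /infixP[p [q ->]] /cat_sorted2[_ /cat_sorted2[]]; by [].
Qed.

(** No two [None] are adjacent, so there is at most one more of them than other letters. *)
Lemma size_erase s : expansion_like s -> size s <= (size (erase s)).*2.+1.
Proof.
suff H t a : path expansion_rel a t -> size t + (a == None) <= (size (erase t)).*2.+1.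
  case: s => // a s; rewrite /expansion_like /= => /H.
  by case: a => [x|] /=; lia.
elim: t a => [|b t IH] a /=; first by case: eqP.
rewrite {1}/expansion_rel => /andP[ab /IH]; case: b ab => [x|] /=; first by lia.
by case: a => [y|//] /= _; lia.
Qed.

Definition reexpand s : seq B := expands (erase s).

Definition lead s : seq B := if s is None :: _ then [:: None] else [::].

Definition unlead s : seq B := if s is None :: s' then s' else s.

Definition trail s : seq B := if last None s == Some alpha then [:: None] else [::].

(** On nonempty expansion-like sequences this is [s ++ trail s], in a form that a transducer can
    compute without knowing where the input ends. *)
Definition reexpand_tail s : seq B :=
  if s is None :: s' then None :: reexpand s' else reexpand s.

Lemma lead_unlead s : lead s ++ unlead s = s.
Proof. by case: s => [|[]]. Qed.

Lemma unlead_cat s t : s != [::] -> unlead (s ++ t) = unlead s ++ t.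
Proof. by case: s => [|[]]. Qed.

Lemma trail_cat s t : t != [::] -> trail (s ++ t) = trail t.
Proof. by case: t => // a t _; rewrite /trail last_cat. Qed.

Lemma reexpand_tailE s : s != [::] -> expansion_like s ->
  reexpand_tail s = s ++ trail s.
Proof.
case: s => // a s _; rewrite /expansion_like /=.
elim: s a => [|b s IH] [x|] //=.
- move=> _; rewrite /reexpand /= expands_cons /trail /= /expand_letter.
  by rewrite -[Some x == Some alpha]/(x == alpha); case: ifP.
- rewrite {1}/expansion_rel -[Some x == Some alpha]/(x == alpha) => /andP[bx /IH].
  rewrite /reexpand_tail /trail /= /reexpand [erase (Some x :: _)]/= expands_cons.
  move: bx; rewrite /expand_letter; case: b => [y|]; case: (x == alpha) => //= _.
    by move=> ->.
  by move=> [->].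
- by rewrite {1}/expansion_rel => /andP[bN /IH]; case: b bN => // y _ <-.
Qed.

Lemma reexpandE s : s != [::] -> expansion_like s ->
  reexpand s = unlead s ++ trail s.
Proof.
move=> s0 /(reexpand_tailE s0); by case: s s0 => [//|[x|] s] _ //= [].
Qed.

(** Across the cut, [expansion_rel] makes [t] start with [None] exactly when [s] ends with
    [Some alpha]. *)
Lemma trail_lead s t : s != [::] -> t != [::] -> expansion_like (s ++ t) ->
  trail s = lead t.
Proof.
case: s => // a s _; case: t => // b t _; rewrite /expansion_like /= cat_path /=.
move=> /and3P[_ + _]; rewrite /expansion_rel /trail /=.
by case: b => [y|] /= /eqP <-.
Qed.

End ExpansionWords.

Lemma lang_infix (A : finType) (X : subshift A) s t :
  infix s t -> lang X t -> lang X s.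
Proof.
move=> /infixP[p [q ->]] [x Xx [i E]].
have -> : s = take (size s) (drop (size p) (p ++ s ++ q)).
  by rewrite drop_size_cat// take_size_cat.
by rewrite E drop_window take_window; exact: lang_window.
Qed.

Lemma window_cat (A : finType) (x : fullshift A) i m n :
  window x i (m + n) = window x i m ++ window x (i + m%:Z)%R n.
Proof.
rewrite -[LHS](cat_take_drop m) take_window drop_window addKn.
by rewrite (minn_idPl (leq_addr _ _)).
Qed.

(** * The language of a symbol expansion *)

Section ExpansionLanguage.
Variables (A : finType) (X : subshift A) (alpha : A).
Variable X' : subshift (option A).
Hypothesis XX' : symbol_expansion X alpha X'.

Lemma lang_expands u : lang X u -> lang X' (expands alpha u).
Proof.
case: u => [_|a u Xu]; first exact: lang_nil.
have := XX'.1 (expand alpha (Word (isT : a :: u != [::]))).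
by apply; exists (Word (isT : a :: u != [::])).
Qed.

(** The candidate subshift to which the minimality of [X'] is applied. *)
Definition expansion_points : set (fullshift (option A)) :=
  [set y | subshift_set X' y /\ forall i n, exists2 t, lang X t &
    infix (window y i n) (expands alpha t)].

Lemma expansion_points_closed : closed expansion_points.
Proof.
move=> y cly; split.
  by apply: subshift_closed => U /cly[z [[Xz _] Uz]]; exists z.
move=> i n; have [z [[_ zP] zy]] := cly _ (cylinder_nbhs y (absz i + n)).
rewrite (_ : window y i n = window z i n); first exact: zP.
by apply: eq_window => k kn; rewrite zy//; lia.
Qed.

Lemma expansion_points_shift :
  @shiftmap (option A) @` expansion_points = expansion_points.
Proof.
apply/seteqP; split=> [_ [y [Xy yP] <-]|y [Xy yP]].
  split; first by rewrite -(subshift_shift X'); exists y.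
  move=> i n; rewrite (_ : window _ i n = window y (i + 1)%R n); first exact: yP.
  by apply: eq_window => k kn; rewrite /shiftmap; congr y; lia.
exists (fun i => y (i - 1)%R); last first.
  by apply: funext => i; rewrite /shiftmap GRing.addrK.
split; first exact: subshift_translate.
move=> i n; rewrite (_ : window _ i n = window y (i - 1)%R n); first exact: yP.
by apply: eq_window => k kn; congr y; lia.
Qed.

(* A limit of points of [X'] carrying the expansions of longer and longer
   extensions of the word. *)
Lemma expansion_points_window x k : subshift_set X x ->
  exists2 y, expansion_points y &
    window y 0%R (size (expands alpha (window x 0%R k))) =
    expands alpha (window x 0%R k).
Proof.
move=> Xx; set w := window x 0%R k.
pose a n := expands alpha (window x (- n%:Z)%R n).
pose b n := expands alpha (window x k n).
have tE n : expands alpha (window x (- n%:Z)%R (n + (k + n))) =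
    a n ++ expands alpha w ++ b n.
  rewrite !window_cat !expands_cat; congr (_ ++ expands alpha _ ++ expands alpha _).
    by apply: eq_window => j _; congr x; lia.
  by apply: eq_window => j _; congr x; lia.
have an n : n <= size (a n).
  by apply: leq_trans (size_expands _ _); rewrite size_mkseq.
have bn n : n <= size (b n).
  by apply: leq_trans (size_expands _ _); rewrite size_mkseq.
have /choice[y yP] n : exists y, subshift_set X' y /\
    window y (- (size (a n))%:Z)%R (size (a n ++ expands alpha w ++ b n)) =
    a n ++ expands alpha w ++ b n.
  have [|y Xy [i E]] := @lang_expands (window x (- n%:Z)%R (n + (k + n))).
    exact: lang_window.
  (* Translated so that the expansion of [w] starts at [0]. *)
  exists (fun j => y (j + (i + (size (a n))%:Z))%R).
  split; first exact: subshift_translate.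
  rewrite -tE [RHS]E; apply: eq_window => j _; congr y; lia.
have wE n : window (y n) 0%R (size (expands alpha w)) = expands alpha w.
  have [_] := yP n; rewrite !size_cat !window_cat => /eqP.
  rewrite !eqseq_cat ?size_mkseq// => /and3P[_ /eqP <- _].
  by rewrite size_mkseq; apply: eq_window => j _; congr (y n); lia.
have [z Xz zP] := subshift_cluster (fun n => (yP n).1).
exists z; last first.
  have [n _ yz] := zP (size (expands alpha w)) 0.
  by rewrite -[RHS](wE n); apply: eq_window => j jw; rewrite yz//; lia.
split=> // i l; have [n nl yz] := zP (absz i + l)%N (absz i + l)%N.
(* The window lies in the block carried by [y n], which reaches at least [n] letters to both sides
   of [0]. *)
exists (window x (- n%:Z)%R (n + (k + n))); first exact: lang_window.
rewrite tE -(yP n).2.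
have -> : window z i l = window (y n) i l.
  by apply: eq_window => j jl; rewrite yz//; lia.
set N := size (_ ++ _).
pose p := absz (i + (size (a n))%:Z)%R.
have anN := an n; have bnN := bn n.
have Np : N = (p + (l + (N - p - l)))%N.
  by rewrite /N !size_cat /p; lia.
rewrite [N]Np !window_cat.
have -> : (- (size (a n))%:Z + p%:Z)%R = i by rewrite /p; lia.
exact: infix_infix.
Qed.

Lemma expansion_points_nonempty : expansion_points !=set0.
Proof.
have [x Xx] := subshift_nonempty X.
by have [y yP _] := expansion_points_window 0 Xx; exists y.
Qed.

(** [expansion_points] is a subshift whose language contains the expansions, so it contains [X'] by
    minimality. *)
Lemma lang_expansion s : lang X' s ->
  exists2 u, lang X u & infix s (expands alpha u).
Proof.
move=> [y X'y [i ->]].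
pose Z := Subshift expansion_points_closed expansion_points_nonempty
  expansion_points_shift.
suff : X' `<=` Z by move=> /(_ y X'y)[_]; exact.
apply: XX'.2 => _ [u [x Xx [i' uE]] <-].
have [z zP zE] := expansion_points_window (size u) (subshift_translate i' Xx).
have uw : wseq u = window (fun j => x (j + i')%R) 0%R (size u).
  by rewrite {1}uE; apply: eq_window => j _; congr x; lia.
exists z => //; exists 0%R.
by rewrite -uw in zE; exact: esym zE.
Qed.

Lemma lang_expansion_like s : lang X' s -> expansion_like alpha s.
Proof.
by move=> /lang_expansion[u _ su]; apply: expansion_like_infix su (expands_like _ _).
Qed.

Lemma lang_erase s : lang X' s -> lang X (erase s).
Proof.
move=> /lang_expansion[u Xu /infix_erase_mono]; rewrite expandsK => su.
exact: lang_infix su Xu.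
Qed.

Lemma admissible_expands n u : admissible X n.+1 u ->
  admissible X' n (expands alpha u).
Proof.
move=> uX s /infix_expands[u' [u'u us su]] sn.
apply: lang_infix su (lang_expands (uX _ u'u _)).
by rewrite (leq_trans us).
Qed.

(** [expansion_rel] only relates consecutive letters, so factors of length two decide. *)
Lemma admissible_like s : admissible X' 2 s -> expansion_like alpha s.
Proof.
elim: s => // a [//|b s] IH sX; rewrite /expansion_like /=.
apply/andP; split.
  have /lang_expansion_like : lang X' [:: a; b].
    by apply: sX => //; apply/infixP; exists [::], s.
  by rewrite /expansion_like /= andbT.
apply: IH; apply: admissible_infix sX.
by apply/infixP; exists [:: a], [::]; rewrite cats0.
Qed.

Lemma admissible_erase n s : expansion_like alpha s ->
  admissible X' n.*2.+1 s -> admissible X n (erase s).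
Proof.
move=> sl sX u /infix_erase[t ts <-] tn; apply/lang_erase/sX => //.
apply: leq_trans (size_erase (expansion_like_infix ts sl)) _.
by rewrite ltnS leq_double.
Qed.

End ExpansionLanguage.

(** * The functors of expansion and erasure *)

Section MiddleMap.
Variables (V : pseudovariety) (V_LSl : forall S : finSemigroupType, LSl S -> V S).
Variables (A B : finType) (f : word A -> word B) (fc : vcont V f).

Definition middle_map (x : profree V A * profree V A * profree V A) :
    profree V B := ext fc x.1.2.

Variables (X : subshift A) (Y : subshift B) (N : nat -> nat).
Hypothesis fP : forall u v : word A, 1 < size u -> 1 < size v ->
  admissible X 2 u -> admissible X 2 v -> f (u * v) = f u * f v.
Hypothesis fY : forall n (u : word A), 1 < size u -> admissible X 2 u ->
  admissible X (N n) u -> admissible Y n (f u).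

(** The hypotheses on [f] are restricted to words with at least two letters because the erasure of
    one letter may be empty; the approximations [h u k] of an arrow are long enough. *)
Lemma middle_map_mirage : mirage_map X Y middle_map.
Proof.
have sz (h u k : word A) : 1 < size (h * (u * k)).
  by have := word_gt0 h; have := word_gt0 u; rewrite !size_cat; lia.
split=> [|e u k v g hu hv|[[e u] k] hx].
- pose T := (profree V A * profree V A * profree V A)%type.
  have c12 : continuous (fun x : T => x.1.2).
    exact: continuous_comp_fun (@fst_continuous _ _) (@snd_continuous _ _).
  have H := continuous_comp_fun c12 (ext_continuous (fc := fc)); exact: H.
- have [le lk lu] := lim_arrow 0 hu; have [_ lg lv] := lim_arrow 0 hv.
  have [_ _ _ Mu] := hu; have [_ _ _ Mv] := hv.
  apply: (lim_unique (lim_ext fc (lim_mul lu lv))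
    (lim_mul (lim_ext fc lu) (lim_ext fc lv))).
  have := eventually_and (lim_mirage V_LSl 2 lu Mu) (lim_mirage V_LSl 2 lv Mv).
  by apply: eventuallyS => s [uX vX]; apply: fP.
- have [le lk lu] := lim_arrow 0 hx; have [_ _ _ Mu] := hx.
  apply: (mirage_lim V_LSl (lim_ext fc lu)) => n.
  have := eventually_and (lim_mirage V_LSl 2 lu Mu) (lim_mirage V_LSl (N n) lu Mu).
  by apply: eventuallyS => s [uX vX]; apply: fY.
Qed.

End MiddleMap.

Lemma transduce0 (A B : Type) (g : A -> seq B) s :
  transduce 0 (fun=> g) [::] s = flatten (map g s).
Proof. by elim: s => //= a s <-. Qed.

Section ExpansionMaps.
Variables (V : pseudovariety) (V_monoidal : monoidal V).
Hypothesis V_LSl : forall S : finSemigroupType, LSl S -> V S.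
Hypothesis V_D : forall S : finSemigroupType, V S <-> semidirect_pv V Dpv S.
Variables (A : finType) (alpha : A).
Local Notation B := (option A).

(** [letterA] and [letterB] are defaults for outputs that would be empty. *)
Definition letterA : word A := Word (isT : [:: alpha] != [::]).
Definition letterB : word B := Word (isT : [:: None] != [::]).

Lemma vcont_expand : vcont V (expand alpha).
Proof.
have := vcont_transduction V_monoidal V_LSl V_D 0 (fun=> expand_letter alpha) letterB.
congr vcont; apply: funext => w; apply: val_inj.
by rewrite val_insubd transduce0 ifT// (valP (expand alpha w)).
Qed.

Definition werase (w : word B) : word A := insubd letterA (erase w).

Lemma vcont_werase : vcont V werase.
Proof.
have := vcont_transduction V_monoidal V_LSl V_D 0
  (fun=> fun b : B => if b is Some a then [:: a] else [::]) letterA.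
congr vcont; apply: funext => w; congr (insubd _ _).
rewrite transduce0; elim: (wseq w) => //= b s ->.
by case: b.
Qed.

(** With contexts of length [1], the empty context marks the first letter of the input. *)
Definition first_letter (T T' : Type) (g h : T -> seq T') : seq T -> T -> seq T' :=
  fun x => if x is [::] then g else h.

Lemma transduce_first (T T' : Type) (g h : T -> seq T') a s :
  transduce 1 (first_letter g h) [::] (a :: s) = g a ++ flatten (map h s).
Proof.
suff H b : transduce 1 (first_letter g h) [:: b] s = flatten (map h s).
  exact: (congr1 (cat (g a)) (H a)).
by elim: s b => //= c s IH b; rewrite -(IH c).
Qed.

Definition wunlead (w : word B) : word B := insubd letterB (unlead w).

Lemma vcont_wunlead : vcont V wunlead.
Proof.
have := vcont_transduction V_monoidal V_LSl V_D 1
  (first_letter (fun b : B => if b is Some _ then [:: b] else [::]) (fun b => [:: b]))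
  letterB.
congr vcont; apply: funext => w; congr (insubd _ _).
have flat1 s : flatten [seq [:: b] | b <- s] = s by elim: s => //= b s ->.
by case: w => -[//|[a|] s] i; rewrite transduce_first /= flat1.
Qed.

Definition wtail (w : word B) : word B := insubd letterB (reexpand_tail alpha w).

Lemma vcont_wtail : vcont V wtail.
Proof.
pose h (b : B) := if b is Some a then expand_letter alpha a else [::].
have := vcont_transduction V_monoidal V_LSl V_D 1
  (first_letter (fun b : B => if b is None then [:: None] else h b) h) letterB.
congr vcont; apply: funext => w; congr (insubd _ _).
have flath s : flatten [seq h b | b <- s] = reexpand alpha s.
  by elim: s => //= -[x|] s ->.
by case: w => -[//|[a|] s] i; rewrite transduce_first /= flath.
Qed.

Variables (X : subshift A) (X' : subshift B).
Hypothesis XX' : symbol_expansion X alpha X'.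

Lemma erase_neq0 s : 1 < size s -> expansion_like alpha s -> erase s != [::].
Proof.
move=> s1 /size_erase; case: (erase s) => //=; lia.
Qed.

Lemma val_werase (w : word B) : 1 < size w -> expansion_like alpha w ->
  werase w = erase w :> seq A.
Proof. by move=> w1 wl; rewrite val_insubd erase_neq0. Qed.

Lemma val_reexpand (w : word B) : 1 < size w -> expansion_like alpha w ->
  expand alpha (werase w) = unlead w ++ trail alpha w :> seq B.
Proof.
move=> w1 wl; rewrite -reexpandE//; last by case: (w).
by rewrite /= val_werase.
Qed.

Lemma val_wunlead (w : word B) : 1 < size w -> wunlead w = unlead w :> seq B.
Proof. by case: w => -[//|[a|] [|b s]] // w0 _; rewrite val_insubd. Qed.

Lemma val_wtail (w : word B) : expansion_like alpha w ->
  wtail w = w ++ trail alpha w :> seq B.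
Proof.
move=> wl; rewrite val_insubd reexpand_tailE//; last by case: (w).
by rewrite ifT//; case: (w) => -[].
Qed.

Lemma expand_map_mirage : mirage_map X X' (middle_map vcont_expand).
Proof.
apply: (middle_map_mirage V_LSl vcont_expand (N := S)) => [u v _ _ _ _|n u _ _].
  exact: expandM.
exact: (admissible_expands XX').
Qed.

Lemma erase_map_mirage : mirage_map X' X (middle_map vcont_werase).
Proof.
apply: (middle_map_mirage V_LSl vcont_werase (N := fun n => n.*2.+1)).
  move=> u v u1 v1 /(admissible_like XX') ul /(admissible_like XX') vl.
  apply: val_inj; rewrite /= val_insubd /= erase_cat !val_werase//.
  by rewrite ifT//; case: (erase u) (erase_neq0 u1 ul).
move=> n u u1 /(admissible_like XX') ul uX.
by rewrite val_werase//; exact: (admissible_erase XX').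
Qed.

Lemma erase_expandK x : is_arrow X x ->
  middle_map vcont_werase (arrow_map (middle_map vcont_expand) x) = x.1.2.
Proof.
case: x => [[e u] k] _; have lu := lim_approx u.
apply: (lim_unique (lim_ext vcont_werase (lim_ext vcont_expand lu)) lu).
apply: eventually_true => s; apply: val_inj.
rewrite val_insubd -[wseq (expand _ _)]/(expands alpha _) expandsK ifT//.
by case: (approx s u).
Qed.

Local Notation q := (fun x => ext vcont_expand (ext vcont_werase x)).
Local Notation t := (ext vcont_wunlead).
Local Notation t' := (ext vcont_wtail).

Lemma wsize_mul (u v : word B) : 1 < size (u * v).
Proof. by rewrite size_cat -(addn1 1) leq_add ?word_gt0. Qed.

(** On a word [w] approximating [e], [t] gives [unlead w], [t'] gives [w ++ trail w] and [q] gives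
    [unlead w ++ trail w]. As [w w] also approximates [e], eventually [trail w = lead w], and
    everything reduces to [lead w ++ unlead w = w]. *)
Lemma reexpansion_iso e : idem e -> mirage V X' e ->
  [/\ t e * t' e = q e, t' e * t e = e,
     t' e = e * t' e * q e & t e = q e * t e * e].
Proof.
move=> ee Me.
(* Exponent [1] means the square of the approximation, which has at least two letters. *)
pose w (s : vcongruence V B) := wpow (approx s e) 1.
have w0 s : w s != [::] :> seq _ by case: (w s).
have lw : lim w e by exact: lim_wpow ee (lim_approx e).
have w1 s : 1 < size (w s) by exact: wsize_mul.
clearbody w.
have lww : lim (fun s => w s * w s) e by rewrite -[X in lim _ X]ee; exact: lim_mul.
have lwww : lim (fun s => w s * (w s * w s)) e.
  by rewrite -[X in lim _ X]ee; exact: lim_mul.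
(* Values at [e] can be read off any net tending to [e]; choosing among [w], [w w] and [w w w] makes
   the two sides of each identity equal as words. *)
have lt (z : vcongruence V B -> word B) : lim z e ->
  lim (fun s => wunlead (z s)) (t e) := fun h => lim_ext _ h.
have lt' (z : vcongruence V B -> word B) : lim z e ->
  lim (fun s => wtail (z s)) (t' e) := fun h => lim_ext _ h.
have lq (z : vcongruence V B -> word B) : lim z e ->
  lim (fun s => expand alpha (werase (z s))) (q e) :=
  fun h => lim_ext _ (lim_ext _ h).
have E := lim_mirage V_LSl 2 lwww Me.
have {E} E : eventually (fun s => [/\
    expansion_like alpha (w s ++ w s ++ w s), expansion_like alpha (w s ++ w s),
    expansion_like alpha (w s) & trail alpha (w s) = lead (w s)]).
  apply: eventuallyS E => s /(admissible_like XX') wl.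
  have wwl : expansion_like alpha (w s ++ w s).
    by apply: expansion_like_infix wl; exact: suffix_infix.
  split=> //.
    by apply: expansion_like_infix wwl; exact: suffix_infix.
  exact: trail_lead (w0 s) (w0 s) wwl.
split.
- apply: (lim_unique (lim_mul (lt _ lw) (lt' _ lw)) (lq _ lww)).
  apply: eventuallyS E => s [wl3 wl2 wl1 tl]; apply: val_inj => /=.
  rewrite -[RHS]/(wseq (expand _ _)) val_reexpand ?wsize_mul//=.
  by rewrite val_wunlead// val_wtail// unlead_cat// trail_cat// catA.
- apply: (lim_unique (lim_mul (lt' _ lw) (lt _ lw)) lww).
  apply: eventuallyS E => s [wl3 wl2 wl1 tl]; apply: val_inj => /=.
  by rewrite val_wunlead// val_wtail// -catA tl lead_unlead.
- apply: (lim_unique (lt' _ lwww) (lim_mul (lim_mul lw (lt' _ lw)) (lq _ lw))).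
  apply: eventuallyS E => s [wl3 wl2 wl1 tl]; apply: val_inj => /=.
  rewrite -[X in _ = _ ++ X]/(wseq (expand _ _)) val_reexpand//.
  have ww0 : w s ++ w s != [::] by case: (w s) (w0 s) => -[].
  rewrite !val_wtail//= -!catA !trail_cat//.
  by rewrite tl (catA (lead _) (unlead _)) lead_unlead.
- apply: (lim_unique (lt _ lwww) (lim_mul (lim_mul (lq _ lw) (lt _ lw)) lw)).
  apply: eventuallyS E => s [wl3 wl2 wl1 tl]; apply: val_inj => /=.
  rewrite -[X in _ = (X ++ _) ++ _]/(wseq (expand _ _)) val_reexpand//.
  rewrite !val_wunlead ?wsize_mul//= unlead_cat// tl -!catA.
  by rewrite (catA (lead _)) lead_unlead.
Qed.

(** On words both sides become [h h v k k] followed by [trail k], where [trail h = lead h] restores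
    the letter removed by [unlead]. *)
Lemma reexpansion_natural e u f : is_arrow X' (e, u, f) -> t' e * q u = u * t' f.
Proof.
move=> hx; have [/= ee ff uE Mu] := hx.
have [le lf lu] := lim_arrow 1 hx.
have eu : e * u = u by rewrite uE !mulgA ee.
have uf : u * f = u by rewrite uE -!mulgA ff.
(* [u] is read as [u f] on the left and as [e u] on the right, so that the two words coincide. *)
have luf := lim_mul lu lf; have leu := lim_mul le lu.
rewrite [X in lim _ X]uf in luf; rewrite [X in lim _ X]eu in leu.
apply: (lim_unique
  (lim_mul (lim_ext vcont_wtail le) (lim_ext vcont_expand (lim_ext vcont_werase luf)))
  (lim_mul leu (lim_ext vcont_wtail lf))).
apply: eventuallyS (lim_arrow_admissible V_LSl 1 2 hx) => s.
have h1 : 1 < size (wpow (approx s e) 1) by exact: wsize_mul.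
have k1 : 1 < size (wpow (approx s f) 1) by exact: wsize_mul.
move: (wpow (approx s e) 1) (wpow (approx s f) 1) (approx s u) h1 k1.
move=> h k v h1 k1 /= /(admissible_like XX') wl; apply: val_inj => /=.
have h0 : h != [::] :> seq _ by case: (h).
have k0 : k != [::] :> seq _ by case: (k).
have like s' : infix s' (h ++ (h ++ v ++ k) ++ k) -> expansion_like alpha s'.
  by move=> i; apply: expansion_like_infix i wl.
have hl : expansion_like alpha h by apply: like; exact: prefix_infix.
have kl : expansion_like alpha k by apply: like; rewrite catA suffix_infix.
have hhl : expansion_like alpha (h ++ h).
  by apply: like; rewrite -!catA catA prefix_infix.
have hvl : expansion_like alpha ((h ++ v ++ k) ++ k).
  by apply: like; exact: suffix_infix.
rewrite -[X in _ ++ X = _]/(wseq (expand _ (werase ((h * (v * k)) * k)))).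
rewrite val_reexpand ?wsize_mul//= !val_wtail//.
rewrite -!catA unlead_cat// (trail_lead h0 h0 hhl) -!catA.
rewrite (catA (lead _)) lead_unlead.
by rewrite !catA trail_cat.
Qed.

End ExpansionMaps.

Lemma expansion_equiv (V : pseudovariety) (V_monoidal : monoidal V)
    (V_LSl : forall S : finSemigroupType, LSl S -> V S)
    (V_D : forall S : finSemigroupType, V S <-> semidirect_pv V Dpv S)
    (A : finType) (X : subshift A) (alpha : A) (X' : subshift (option A)) :
  symbol_expansion X alpha X' ->
  continuously_equivalent (karoubi_mirage V_LSl X) (karoubi_mirage V_LSl X').
Proof.
move=> XX'.
have EP := expand_map_mirage V_monoidal V_LSl V_D XX'.
have DP := erase_map_mirage V_monoidal V_LSl V_D XX'.
exists (mirage_functor V_LSl EP), (mirage_functor V_LSl DP); split; last first.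
  by apply: mirage_functor_inverse; exact: (erase_expandK V_monoidal V_LSl V_D).
pose E := ext (vcont_expand V_monoidal V_LSl V_D alpha).
pose D := ext (vcont_werase V_monoidal V_LSl V_D alpha).
apply: (@ciso_mirage_id V V_LSl _ X' _ (fun x => E (D x))
  (ext (vcont_wunlead V_monoidal V_LSl V_D (A := A)))
  (ext (vcont_wtail V_monoidal V_LSl V_D alpha))) => //.
- exact: (continuous_comp_fun (ext_continuous (fc := _)) (ext_continuous (fc := _))).
- exact: ext_continuous.
- by move=> e ee Me; exact: (reexpansion_iso V_monoidal V_LSl V_D XX').
- by move=> e u f; exact: (reexpansion_natural V_monoidal V_LSl V_D XX').
Qed.

(** * Invariance under flow equivalence *)

Theorem theorem6p10 (V : pseudovariety) (V_monoidal : monoidal V)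
    (V_LSl : forall S : finSemigroupType, LSl S -> V S)
    (V_D : forall S : finSemigroupType, V S <-> semidirect_pv V Dpv S)
    (A B : finType) (X : subshift A) (Y : subshift B) :
  flow_equivalent X Y ->
  continuously_equivalent (karoubi_mirage V_LSl X) (karoubi_mirage V_LSl Y).
Proof.
elim=> {A B X Y}.
- by move=> A B X Y; exact: conjugate_equiv.
- by move=> A X alpha X'; exact: expansion_equiv.
- by move=> A X; exact: cequiv_refl.
- by move=> A B X Y _; exact: cequiv_sym.
- by move=> A B C X Y Z _ XY _; exact: cequiv_trans XY.
Qed.
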